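(* There is a universal real constant $c_1$ with $0<c_1\le 10$ such that the following holds for every positive integer $n$. Let $h,w$ be positive real numbers with $w>1$ and $$h\ \ge\ c_1 n^4\log n+\log w .$$ Then for a point $M\in\mathbb{P}(\mathcal{M}_n(\mathbb{Q}))$ chosen uniformly at random among all points of $\mathbb{P}(\mathcal{M}_n(\mathbb{Q}))$ of bit length at most $h$, the condition number satisfies $k(M)<w\,n^{5/2}$ with probability at least $$1-\frac{2}{w}.$$
   Context: $\mathcal{M}_n(\mathbb{Q})$ is the vector space of $n\times n$ rational matrices and $\mathbb{P}(\mathcal{M}_n(\mathbb{Q}))$ its projective space. Condition number: for a nonzero matrix $M$, $k(M):=\|M^{-1}\|\,\|M\|$, where $\|M\|:=\sup\{\|Mv\|: v\in\mathbb{R}^n,\ \|v\|=1\}$ is the operator norm for the Euclidean norm, and $k(M)=\infty$ if $M$ is singular. It depends only on the projective class of $M$. Height: for a projective point $P$ represented by a nonzero rational matrix $M=(x_{i,j})$, the Northcott–Schmidt height is $$H(P):=\|M\|_F\prod_{p\ \mathrm{prime}}\max\{|x_{i,j}|_p:1\le i,j\le n\},$$ where $\|M\|_F=(\sum_{i,j} x_{i,j}^2)^{1/2}$ is the Frobenius norm and $|\cdot|_p$ is the $p$-adic absolute value. Equivalently, $H(P)=\|M_0\|_F$ for an integer matrix $M_0$ representing $P$ whose entries have greatest common divisor $1$. There are finitely many points of bounded height. Bit length: the bit length of $P$ is $\log_2 H(P)$. All logarithms are to base $2$. *)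

(* Defs.v *)
From HB Require Import structures.
From mathcomp Require Import all_boot all_order all_algebra.
From mathcomp Require Import finmap.
From mathcomp Require Import all_classical all_reals all_analysis.

Set Implicit Arguments.
Unset Strict Implicit.
Unset Printing Implicit Defensive.

Import Order.TTheory GRing.Theory Num.Theory.
Local Open Scope classical_set_scope.
Local Open Scope ring_scope.

Definition log2 (R : realType) (x : R) : R := ln x / ln 2.

(* A point of P(V) is a line of V. Functions of a point are computed below on
   the nonzero representative [vpick P]; [height] and [condition_number] are
   invariant under scaling by a nonzero rational. *)
Definition projective_space (K : fieldType) (V : vectType K) :
  set {vspace V} := [set P | \dim P = 1%N].

(* The Euclidean norm of a vector when m = 1 or n = 1. (The norm that the
   library puts on matrices is the sup norm.) *)
Definition frobenius_norm (R : realType) (m n : nat) (A : 'M[R]_(m, n)) : R :=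
  Num.sqrt (\sum_i \sum_j A i j ^+ 2).

Definition operator_norm (R : realType) (n : nat) (A : 'M[R]_n) : R :=
  sup [set frobenius_norm (A *m v) | v in [set v : 'cV[R]_n |
                                            frobenius_norm v = 1]].

Definition condition_number (R : realType) (n : nat) (A : 'M[R]_n) : \bar R :=
  if A \in unitmx then (operator_norm (invmx A) * operator_norm A)%:E
  else +oo%E.

(* For x != 0 this is p ^ (- v_p(x)), where v_p(x) = v_p(numq x) - v_p(denq x). *)
Definition padic_abs (R : realType) (p : nat) (x : rat) : R :=
  if x == 0 then 0
  else p%:R ^ ((logn p `|denq x|%N)%:Z - (logn p `|numq x|%N)%:Z).

Definition padic_max (R : realType) (p n : nat) (M : 'M[rat]_n) : R :=
  \big[Num.max/0]_(ij : 'I_n * 'I_n) padic_abs R p (M ij.1 ij.2).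

(* The product over all primes has finite support when M != 0: the factor at p
   differs from 1 only if p divides the numerators of all the entries or the
   denominator of some entry. *)
Definition height (R : realType) (n : nat) (M : 'M[rat]_n) : R :=
  frobenius_norm (map_mx ratr M : 'M[R]_n) *
  \big[*%R/1]_(p \in [set p : nat | prime p]) padic_max R p M.

Definition bit_length (R : realType) (n : nat) (P : {vspace 'M[rat]_n}) : R :=
  log2 (height R (vpick P)).

Definition point_condition_number (R : realType) (n : nat)
    (P : {vspace 'M[rat]_n}) : \bar R :=
  condition_number (map_mx ratr (vpick P) : 'M[R]_n).

Definition points_of_bit_length_le (R : realType) (n : nat) (h : R) :
    set {vspace 'M[rat]_n} :=
  [set P | projective_space P /\ bit_length R P <= h].
Arguments points_of_bit_length_le {R} n h.

(* The probability that a uniformly random element of A, which is meant to be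
   finite and nonempty, lies in E. *)
Definition uniform_probability (R : realType) (T : choiceType)
    (A E : set T) : R :=
  (#|` fset_set (A `&` E)|%fset)%:R / (#|` fset_set A|%fset)%:R.

(* Main.v *)
Require Import Defs.
From HB Require Import structures.
From mathcomp Require Import all_boot all_order all_algebra.
From mathcomp Require Import finmap.
From mathcomp Require Import all_classical all_reals all_analysis.
From mathcomp Require Import ring lra zify.

Set Implicit Arguments.
Unset Strict Implicit.
Unset Printing Implicit Defensive.

Import Order.TTheory GRing.Theory Num.Theory.
Local Open Scope classical_set_scope.
Local Open Scope ring_scope.


(* Points of height at most H := 2 ^ h correspond, up to sign, to the primitive
   integer matrices in the Frobenius ball of radius H. If k(M) >= w n^(5/2),
   then some column of M lies at distance at most H / (w n^2) from the span of
   the other columns, that is, M lies in a slab along a unit normal u of that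
   span. Adding to this column the integer roundings of k u, for all k that keep
   it within distance H / n of the span, spreads the slab over the ball of
   radius about H sqrt(1 + 1/n^2), which has at most (1 + 1/n^2)^(n^2/2)
   <= sqrt 3 times as many lattice points as the ball of radius H; each slab
   thus contains a proportion at most about sqrt 3 / (w n) of the lattice points
   of the ball. Summing over the n columns and dividing by the proportion of
   primitive matrices, at least 1 - sum_(d >= 2) d^-4 > 0.87, gives a constant
   below 2. The lower bound on h makes all rounding errors negligible. *)

(** * Euclidean norms *)

Lemma sum_cauchy_schwarz (R : realType) (I : finType) (f g : I -> R) :
  (\sum_i f i * g i) ^+ 2 <= (\sum_i f i ^+ 2) * (\sum_i g i ^+ 2).
Proof.
set a := \sum_i f i ^+ 2; set b := \sum_i f i * g i; set c := \sum_i g i ^+ 2.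
have a0 : 0 <= a by apply: sumr_ge0 => i _; exact: sqr_ge0.
have key s t : 0 <= s ^+ 2 * a + s * t * b *+ 2 + t ^+ 2 * c.
  have -> : s ^+ 2 * a + s * t * b *+ 2 + t ^+ 2 * c =
            \sum_i (s * f i + t * g i) ^+ 2.
    rewrite /a /b /c -mulrnAr -sumrMnl !mulr_sumr -!big_split /=.
    by apply: eq_bigr => i _; ring.
  by apply: sumr_ge0 => i _; exact: sqr_ge0.
have [a_eq0|a_neq0] := eqVneq a 0.
  have f0 i : f i = 0.
    apply/eqP; rewrite -sqrf_eq0; apply/eqP.
    by apply: (psumr_eq0P _ a_eq0) => // j _; exact: sqr_ge0.
  by rewrite /b big1 ?expr0n ?a_eq0 ?mul0r // => i _; rewrite f0 mul0r.
have a_gt0 : 0 < a by rewrite lt_def a_neq0.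
(* At (- b, a) the nonnegative quadratic form equals a (a c - b^2); dividing by a > 0 leaves the
   discriminant inequality. *)
have := key (- b) a.
have -> : (- b) ^+ 2 * a + - b * a * b *+ 2 + a ^+ 2 * c = a * (a * c - b ^+ 2).
  by ring.
by rewrite pmulr_rge0 // subr_ge0.
Qed.

Section Frobenius.
Variables (R : realType) (m n : nat).
Implicit Types A B : 'M[R]_(m, n).

Lemma frobenius_norm_ge0 A : 0 <= frobenius_norm A.
Proof. exact: sqrtr_ge0. Qed.

Lemma sqr_frobenius_norm A : frobenius_norm A ^+ 2 = \sum_i \sum_j A i j ^+ 2.
Proof.
rewrite sqr_sqrtr //; apply: sumr_ge0 => i _; apply: sumr_ge0 => j _.
exact: sqr_ge0.
Qed.

Lemma sum_mul_le_frobenius_norm A B :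
  \sum_i \sum_j A i j * B i j <= frobenius_norm A * frobenius_norm B.
Proof.
apply: le_trans (ler_norm _) _; rewrite -(ler_sqr (normr_ge0 _)); last first.
  by rewrite nnegrE mulr_ge0 // frobenius_norm_ge0.
rewrite real_normK ?num_real // exprMn !sqr_frobenius_norm !pair_bigA /=.
exact: (@sum_cauchy_schwarz R ('I_m * 'I_n)%type
  (fun ij => A ij.1 ij.2) (fun ij => B ij.1 ij.2)).
Qed.

Lemma frobenius_normD A B :
  frobenius_norm (A + B) <= frobenius_norm A + frobenius_norm B.
Proof.
rewrite -(@ler_sqr _ _) ?nnegrE ?addr_ge0 ?frobenius_norm_ge0 //.
rewrite sqrrD !sqr_frobenius_norm.
have -> : \sum_i \sum_j (A + B) i j ^+ 2 = \sum_i \sum_j A i j ^+ 2 +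
    (\sum_i \sum_j A i j * B i j) *+ 2 + \sum_i \sum_j B i j ^+ 2.
  rewrite -sumrMnl -!big_split /=; apply: eq_bigr => i _.
  rewrite -sumrMnl -!big_split /=; apply: eq_bigr => j _.
  by rewrite mxE sqrrD.
by rewrite lerD2r lerD2l lerMn2r sum_mul_le_frobenius_norm.
Qed.

Lemma frobenius_normZ (a : R) A :
  frobenius_norm (a *: A) = `|a| * frobenius_norm A.
Proof.
rewrite /frobenius_norm -sqrtr_sqr -sqrtrM ?sqr_ge0 //; congr Num.sqrt.
rewrite mulr_sumr; apply: eq_bigr => i _.
by rewrite mulr_sumr; apply: eq_bigr => j _; rewrite mxE exprMn.
Qed.

Lemma normr_le_frobenius_norm A i j : `|A i j| <= frobenius_norm A.
Proof.
rewrite -(ler_sqr (normr_ge0 _)) ?nnegrE ?frobenius_norm_ge0 //.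
rewrite real_normK ?num_real // sqr_frobenius_norm.
rewrite (bigD1 i) //= (bigD1 j) //= -addrA lerDl addr_ge0 //.
  by apply: sumr_ge0 => k _; exact: sqr_ge0.
by apply: sumr_ge0 => k _; apply: sumr_ge0 => l _; exact: sqr_ge0.
Qed.

Lemma frobenius_norm_eq0 A : (frobenius_norm A == 0) = (A == 0).
Proof.
apply/eqP/eqP => [A0|->].
  apply/matrixP => i j; rewrite mxE; apply/eqP.
  by rewrite -normr_le0 -A0 normr_le_frobenius_norm.
by rewrite -(scale0r (0 : 'M[R]_(m, n))) frobenius_normZ normr0 mul0r.
Qed.

End Frobenius.

Lemma frobenius_norm_le_dim (R : realType) n (A : 'M[R]_n) :
  (forall i j, `|A i j| <= 1) -> frobenius_norm A <= n%:R.
Proof.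
move=> A1; rewrite -(@ler_sqr _ _) ?nnegrE ?frobenius_norm_ge0 //.
rewrite sqr_frobenius_norm.
apply: (@le_trans _ _ (\sum_(i < n) \sum_(j < n) (1 : R))).
  apply: ler_sum => i _; apply: ler_sum => j _.
  by rewrite -real_normK ?num_real // expr_le1.
by rewrite !sumr_const !card_ord -mulrnA -natrX mulnn.
Qed.

(** * Counting *)

Definition ncard (T : choiceType) (A : set T) : nat := #|` fset_set A|%fset.

(** All lattice-point comparisons below rest on this double counting: each point of [A] receives
    [#|I|] images, and the label in [J] separates the preimages of a point of [B]. It does the work
    of a volume argument. *)
Lemma ncard_inj (T U : choiceType) (I J : finType) (A : set T) (B : set U)
    (f : T -> I -> U * J) :
  finite_set A -> finite_set B ->
  (forall x i, A x -> B (f x i).1) ->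
  (forall x i y j, A x -> A y -> f x i = f y j -> (x, i) = (y, j)) ->
  (ncard A * #|I| <= ncard B * #|J|)%N.
Proof.
move=> finA finB fAB finj; rewrite /ncard !cardE.
set a := enum_fset (fset_set A); set b := enum_fset (fset_set B).
have ain x : x \in a -> A x.
  by move=> xa; have : x \in fset_set A by []; rewrite in_fset_set // => /set_mem.
rewrite -(size_allpairs (fun x i => f x i) a (enum I)).
rewrite -(size_allpairs pair b (enum J)).
apply: uniq_leq_size.
  apply: allpairs_uniq; [exact: fset_uniq|exact: enum_uniq|].
  move=> [x i] [y j] /allpairsP[[x' i'] /= [xa _ [-> ->]]].
  by move=> /allpairsP[[y' j'] /= [ya _ [-> ->]]] /finj; apply; exact: ain.
move=> _ /allpairsP[[x i] /= [xa _ ->]]; apply/allpairsP.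
exists (f x i); split; [|by rewrite mem_enum|by case: (f x i)].
have : (f x i).1 \in fset_set B.
  by rewrite in_fset_set // inE; apply/fAB/ain.
by [].
Qed.

Lemma ncard_le_inj (T U : choiceType) (A : set T) (B : set U) (f : T -> U) :
  finite_set A -> finite_set B -> (forall x, A x -> B (f x)) ->
  (forall x y, A x -> A y -> f x = f y -> x = y) -> (ncard A <= ncard B)%N.
Proof.
move=> finA finB fAB finj.
have := @ncard_inj T U unit unit A B (fun x _ => (f x, tt)) finA finB.
rewrite card_unit !muln1; apply=> [x _|x [] y []]; first exact: fAB.
by move=> Ax Ay [/finj] ->.
Qed.

Lemma ncard_sub (T : choiceType) (A B : set T) :
  finite_set B -> A `<=` B -> (ncard A <= ncard B)%N.
Proof.
move=> finB AB; apply: (@ncard_le_inj _ _ _ _ id) => //.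
exact: sub_finite_set AB finB.
Qed.

Lemma ncardU (T : choiceType) (A B : set T) :
  finite_set A -> finite_set B -> (ncard (A `|` B) <= ncard A + ncard B)%N.
Proof.
by move=> finA finB; rewrite /ncard fset_setU // cardfsU leq_subr.
Qed.

Lemma finite_bigsetU (T : choiceType) (I : finType) (F : I -> set T) :
  (forall i, finite_set (F i)) -> finite_set (\big[setU/set0]_i F i).
Proof.
by move=> finF; apply: big_ind => // A B finA finB; rewrite finite_setU.
Qed.

Lemma ncard_bigsetU (T : choiceType) (I : finType) (F : I -> set T) :
  (forall i, finite_set (F i)) ->
  (ncard (\big[setU/set0]_i F i) <= \sum_i ncard (F i))%N.
Proof.
move=> finF.
suff [] : finite_set (\big[setU/set0]_i F i) /\
  (ncard (\big[setU/set0]_i F i) <= \sum_i ncard (F i))%N by [].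
elim/big_rec2: _ => [|i m A _ [finA IH]]; first by rewrite /ncard fset_set0 cardfs0.
split; first by rewrite finite_setU.
by apply: leq_trans (ncardU _ _) _ => //; rewrite leq_add2l.
Qed.

Lemma sub_bigsetU (T : choiceType) (I : finType) (F : I -> set T) (i : I) :
  F i `<=` \big[setU/set0]_i F i.
Proof. by move=> x Fx; rewrite (bigD1 i) //=; left. Qed.

Lemma ncard_set1 (T : choiceType) (x : T) : ncard [set x] = 1%N.
Proof. by rewrite /ncard fset_set1 cardfs1. Qed.

(** * Lattice points in balls *)

Section LatticeBall.
Variables (R : realType) (n : nat).
Implicit Types (x y : 'M[int]_n) (r : R).

Definition int_norm x : R := frobenius_norm (map_mx intr x : 'M[R]_n).

Definition lattice_ball r : set 'M[int]_n := [set x | int_norm x <= r].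

Lemma int_normZ (a : int) x : int_norm (a *: x) = `|a%:~R| * int_norm x.
Proof. by rewrite /int_norm map_mxZ frobenius_normZ. Qed.

Lemma int_norm_entry x i j : `|(x i j)%:~R| <= int_norm x.
Proof. by have := normr_le_frobenius_norm (map_mx intr x : 'M[R]_n) i j; rewrite mxE. Qed.

Lemma finite_lattice_ball r : finite_set (lattice_ball r).
Proof.
pose m := Num.truncn `|r|.
pose f (y : 'M['I_((m + m).+1)]_n) : 'M[int]_n := \matrix_(i, j) ((y i j)%:Z - m%:Z).
apply: (@sub_finite_set _ _ (f @` setT)); last first.
  by apply: finite_image; exact: finite_finset.
move=> x /= xr.
exists (\matrix_(i, j) inord (absz (x i j + m%:Z))) => //.
apply/matrixP => i j; rewrite !mxE.
have xm : (absz (x i j) <= m)%N.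
  rewrite /m -ltnS -(ltr_nat R).
  apply: le_lt_trans (truncnS_gt _).
  rewrite natr_absz intr_norm.
  by apply: le_trans (int_norm_entry x i j) _; apply: le_trans xr (ler_norm _).
rewrite inordK; lia.
Qed.

(** Entrywise Euclidean division by p: quotient and remainder determine x, the remainder has p ^ (n
    * n) values, and the quotient differs from x / p by a matrix with entries in [0, 1), hence of
    norm at most n. *)
Lemma ncard_lattice_ball_mulr (p : nat) r : (0 < p)%N ->
  (ncard (lattice_ball (p%:R * r)) <= p ^ (n * n) * ncard (lattice_ball (r + n%:R)))%N.
Proof.
case: p => // p _.
pose f x (_ : unit) : 'M[int]_n * 'M['I_p.+1]_n :=
  (\matrix_(i, j) (x i j %/ p.+1%:Z)%Z, \matrix_(i, j) inord (absz (x i j %% p.+1%:Z)%Z)).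
have := @ncard_inj _ _ unit _ (lattice_ball (p.+1%:R * r))
  (lattice_ball (r + n%:R)) f (finite_lattice_ball _) (finite_lattice_ball _).
rewrite card_unit muln1 card_mx card_ord mulnC; apply.
- move=> x _ /= xr; rewrite /lattice_ball /= /int_norm.
  pose E : 'M[R]_n := \matrix_(i, j) (- ((x i j %% p.+1%:Z)%Z%:~R / p.+1%:R)).
  have -> : map_mx intr (\matrix_(i, j) (x i j %/ p.+1%:Z)%Z) =
     p.+1%:R^-1 *: map_mx intr x + E.
    apply/matrixP => i j; rewrite !mxE {2}(divz_eq (x i j) p.+1%:Z).
    by rewrite intrD intrM -pmulrn; field; rewrite addrC natr1 pnatr_eq0.
  apply: le_trans (frobenius_normD _ _) _; apply: lerD.
    rewrite frobenius_normZ ger0_norm ?invr_ge0 //.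
    by rewrite ler_pdivrMl // ltr0n.
  apply: frobenius_norm_le_dim => i j; rewrite mxE normrN normrM normfV.
  rewrite [in leLHS](ger0_norm (ler0n _ p.+1)) ler_pdivrMr ?ltr0n // mul1r.
  rewrite ger0_norm ?ler0z ?modz_ge0 // pmulrn ler_int ltW //.
  exact: ltz_pmod.
- move=> x [] y [] _ _ [/matrixP dxy /matrixP mxy]; congr pair.
  apply/matrixP => i j; have := dxy i j; have := mxy i j; rewrite !mxE.
  move/(congr1 val); rewrite /= !inordK; lia.
Qed.

(** The converse comparison: the matrices p x + z, with the entries of z in [0, p), are pairwise
    distinct, and z / p has norm at most n. *)
Lemma mul_ncard_lattice_ball (p : nat) r : (0 < p)%N ->
  (p ^ (n * n) * ncard (lattice_ball r) <= ncard (lattice_ball (p%:R * (r + n%:R))))%N.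
Proof.
case: p => // p _.
pose f x (z : 'M['I_p.+1]_n) : 'M[int]_n * unit :=
  (\matrix_(i, j) (p.+1%:Z * x i j + (z i j)%:Z), tt).
have := @ncard_inj _ _ _ unit (lattice_ball r)
  (lattice_ball (p.+1%:R * (r + n%:R))) f (finite_lattice_ball _) (finite_lattice_ball _).
rewrite card_unit muln1 card_mx card_ord mulnC; apply.
- move=> x z /= xr; rewrite /lattice_ball /= /int_norm.
  pose E : 'M[R]_n := \matrix_(i, j) ((z i j)%:R / p.+1%:R).
  have -> : map_mx intr (\matrix_(i, j) (p.+1%:Z * x i j + (z i j)%:Z)) =
     p.+1%:R *: (map_mx intr x + E).
    apply/matrixP => i j; rewrite !mxE.
    by rewrite intrD intrM -!pmulrn; field; rewrite addrC natr1 pnatr_eq0.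
  rewrite frobenius_normZ ger0_norm // ler_wpM2l //.
  apply: le_trans (frobenius_normD _ _) _; apply: lerD => //.
  apply: frobenius_norm_le_dim => i j; rewrite mxE normrM normfV.
  rewrite !ger0_norm // ler_pdivrMr ?ltr0n // mul1r.
  by rewrite ler_nat ltnW.
- move=> x z y t _ _ [/matrixP e].
  have e1 i j : z i j = t i j :> nat /\ x i j = y i j.
    have := e i j; rewrite !mxE; have := ltn_ord (z i j); have := ltn_ord (t i j).
    move: (x i j) (y i j) (nat_of_ord (z i j)) (nat_of_ord (t i j)).
    move=> a b c d dp cp eq_ab.
    suff ab : a = b by split=> //; move: eq_ab; rewrite ab; lia.
    have eq_cd : p.+1%:Z * (a - b) = d%:Z - c%:Z by lia.
    have [ab|ba|//] := ltgtP a b; exfalso.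
      have : p.+1%:Z * (b - a) >= p.+1%:Z by rewrite ler_peMr //; lia.
      lia.
    have : p.+1%:Z * (a - b) >= p.+1%:Z by rewrite ler_peMr //; lia.
    lia.
  congr pair; apply/matrixP => i j; first exact: (e1 i j).2.
  by apply: val_inj; exact: (e1 i j).1.
Qed.

Lemma ncard_lattice_ball_mono r s : r <= s ->
  (ncard (lattice_ball r) <= ncard (lattice_ball s))%N.
Proof.
move=> rs; apply: ncard_sub (finite_lattice_ball _) _ => x /= /le_trans; exact.
Qed.

End LatticeBall.

Arguments lattice_ball {R} n r _.

(** Induction on k through (1 - (k + 1) x) (1 + x) <= 1 - k x. When k x < 1 this bounds (1 + x)^k by
    1 / (1 - k x), which keeps accumulated rounding errors close to 1. *)
Lemma expr1D_le (R : realType) (x : R) (k : nat) : 0 <= x ->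
  (1 - k%:R * x) * (1 + x) ^+ k <= 1.
Proof.
move=> x0; elim: k => [|k IH]; first by rewrite expr0 mul0r subr0 mulr1.
apply: le_trans IH; rewrite exprS mulrA ler_wpM2r ?exprn_ge0 ?addr_ge0 //.
rewrite -natr1; have : 0 <= k%:R :> R by []. nra.
Qed.

(* Volume-free substitute for vol(l B) = l^(n*n) vol(B): the dilation factor is
   approximated by a rational p / q with q = n ^ 30. *)
Lemma ncard_lattice_ball_scale (R : realType) (n : nat) (H l : R) :
  (2 <= n)%N -> n%:R ^+ 60 <= H -> 1 <= l ->
  (ncard (lattice_ball n (l * H)))%:R <=
    1001 / 1000 * l ^+ (n * n) * (ncard (lattice_ball n H))%:R.
Proof.
move=> n2 nH l1.
have v2 : 2 <= n%:R :> R by rewrite (ler_nat _ 2).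
set v : R := n%:R in v2 nH *.
pose a : R := v ^+ 27.
have a_big : 10 ^+ 6 <= a.
  apply: (@le_trans _ _ (2 ^+ 27)); first by lra.
  by rewrite lerXn2r ?nnegrE //; lra.
have a_gt0 : 0 < a by lra.
have [q q_gt0 Q] : exists2 q, (0 < q)%N & q%:R = v ^+ 3 * a :> R.
  by exists (n ^ 30)%N; rewrite ?expn_gt0 ?natrX -?exprD //; lia.
have v4 : 4 <= v ^+ 2 by rewrite expr2; nra.
have v8 : 8 <= v ^+ 3 by rewrite exprS; nra.
have HE : v ^+ 6 * a ^+ 2 <= H by rewrite -exprM -exprD.
have va : 10 ^+ 6 <= v ^+ 2 * a by nra.
have va_gt0 : 0 < v ^+ 2 * a by lra.
have vQ : v * q%:R = (v ^+ 2 * a) * v ^+ 2 by rewrite Q; ring.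
have Hb : (v * q%:R) * (v ^+ 2 * a) <= H.
  by apply: le_trans HE; rewrite vQ le_eqVlt; apply/orP; left; apply/eqP; ring.
have vq_gt0 : 0 < v * q%:R by rewrite vQ; apply: mulr_gt0; lra.
(* The radius solves q (r + 2 n) = H: one n is lost in contracting from p r to r + n, the other in
   dilating from r + n to H. *)
pose r := H / q%:R - 2 * v.
have qR_gt0 : 0 < q%:R :> R by rewrite ltr0n.
have rQ : r * q%:R = H - 2 * (v * q%:R) by rewrite /r; field; lra.
have H_big : 10 ^+ 6 * (v * q%:R) <= H by apply: le_trans Hb; nra.
have r_gt0 : 0 < r by rewrite -(pmulr_lgt0 _ qR_gt0) rQ; lra.
(* Rounding up makes p r >= l H, so that the ball of radius l H lies in that of radius p r. *)
pose p := (Num.truncn (l * H / r)).+1.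
have H_gt0 : 0 < H by lra.
have p_ge : l * H / r <= p%:R by exact/ltW/truncnS_gt.
have p_le : p%:R <= l * H / r + 1.
  by rewrite /p -natr1 lerD2r truncn_le // divr_ge0 ?mulr_ge0; clear -l1 H_gt0 r_gt0; lra.
(* The 5 is 4 + 1: [h1] contributes 4 for replacing q r by H, [h2] contributes 1 for rounding p
   up. *)
pose x : R := 5 / (v ^+ 2 * a).
have pq : p%:R / q%:R <= l * (1 + x).
  apply: (@le_trans _ _ (l * (H / (r * q%:R)) + q%:R^-1)).
    apply: (@le_trans _ _ ((l * H / r + 1) / q%:R)).
      by rewrite ler_wpM2r // invr_ge0 ltW.
    by rewrite le_eqVlt; apply/orP; left; apply/eqP; field; rewrite !gt_eqF.
  apply: (@le_trans _ _ (l * (H / (r * q%:R)) + l * q%:R^-1)).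
    by rewrite lerD2l ler_peMl // invr_ge0 ltW.
  rewrite -mulrDr ler_wpM2l //; first by clear -l1; lra.
  rewrite rQ.
  have h1 : H / (H - 2 * (v * q%:R)) <= 1 + 4 / (v ^+ 2 * a).
    rewrite ler_pdivrMr; last by clear -H_big vq_gt0; lra.
    rewrite -subr_ge0.
    have -> : (1 + 4 / (v ^+ 2 * a)) * (H - 2 * (v * q%:R)) - H =
       (4 * (H - 2 * (v * q%:R)) - 2 * (v * q%:R * (v ^+ 2 * a))) / (v ^+ 2 * a).
      by field; rewrite !gt_eqF //=; clear -v2; lra.
    by apply: divr_ge0; clear -H_big Hb vq_gt0 va_gt0; lra.
  have h2 : q%:R^-1 <= (v ^+ 2 * a)^-1.
    by rewrite lef_pV2 ?posrE // Q ler_wpM2r 1?ltW // exprS; clear -v2 v4; nra.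
  by rewrite /x; clear -h1 h2; lra.
(* With this bound [expr1D_le] gives (1 + x)^(n * n) <= 1 / (1 - 1 / 1001) = 1001 / 1000. *)
have Nx : (n * n)%:R * x <= 1001^-1.
  rewrite natrM -/v /x; have -> : v * v * (5 / (v ^+ 2 * a)) = 5 / a.
    by field; rewrite !gt_eqF //; clear -v2; lra.
  by rewrite ler_pdivrMr //; clear -a_big; lra.
have x_ge0 : 0 <= x by rewrite divr_ge0 // ltW.
have pqN : (p%:R / q%:R) ^+ (n * n) <= 1001 / 1000 * l ^+ (n * n).
  apply: (@le_trans _ _ ((l * (1 + x)) ^+ (n * n))).
    by rewrite lerXn2r ?nnegrE ?divr_ge0 ?mulr_ge0 //; clear -x_ge0 l1; lra.
  rewrite exprMn mulrC ler_wpM2r ?exprn_ge0 //; first by clear -l1; lra.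
  have := expr1D_le (n * n) x_ge0.
  have : 0 <= (1 + x) ^+ (n * n) by rewrite exprn_ge0 //; clear -x_ge0; lra.
  by move: (_ ^+ _) Nx => z Nx; clear -Nx; nra.
(* Both sides are compared through the ball of radius r + n: contraction by p reaches it from l H,
   dilation by q leads from it to H. *)
have : (ncard (lattice_ball n (l * H)) * q ^ (n * n) <=
        p ^ (n * n) * ncard (lattice_ball n H))%N.
  have e1 : (ncard (lattice_ball n (l * H)) <= ncard (lattice_ball n (p%:R * r)))%N.
    by apply: ncard_lattice_ball_mono; rewrite -ler_pdivrMr.
  have e2 := @ncard_lattice_ball_mulr R n p r isT.
  have := @mul_ncard_lattice_ball R n q (r + n%:R) q_gt0.
  have -> : q%:R * (r + n%:R + n%:R) = H.
    transitivity (r * q%:R + 2 * (v * q%:R)); first by rewrite -/v; ring.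
    by rewrite rQ subrK.
  move=> e3; apply: (@leq_trans (p ^ (n * n) * ncard (lattice_ball n (r + n%:R)) * q ^ (n * n))).
    by rewrite leq_mul2r (leq_trans e1 e2) orbT.
  by rewrite -mulnA leq_mul2l [X in (X <= _)%N]mulnC e3 orbT.
rewrite -(ler_nat R) !natrM !natrX => e.
apply: (@le_trans _ _ ((p%:R / q%:R) ^+ (n * n) * (ncard (lattice_ball n H))%:R)).
  by rewrite expr_div_n mulrAC ler_pdivlMr ?exprn_gt0.
by rewrite ler_wpM2r.
Qed.

(** * Primitive matrices *)

Lemma ncard_image (T U : choiceType) (f : T -> U) (A : set T) :
  finite_set A -> (ncard (f @` A) <= ncard A)%N.
Proof. by move=> finA; rewrite /ncard fset_set_image //; exact: leq_imfset_card. Qed.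

(** This excludes the zero matrix, whose entries every d divides. *)
Definition primitive (n : nat) (x : 'M[int]_n) : Prop :=
  forall d : nat, (forall i j, (d %| x i j)%Z) -> d = 1%N.

Definition primitive_ball (R : realType) (n : nat) (r : R) : set 'M[int]_n :=
  [set x | lattice_ball n r x /\ primitive x].

Arguments primitive_ball {R} n r _.

Lemma finite_primitive_ball (R : realType) n (r : R) : finite_set (primitive_ball n r).
Proof. by apply: sub_finite_set (finite_lattice_ball n r) => x []. Qed.

Lemma int_norm_ge1 (R : realType) n (x : 'M[int]_n) : x != 0 -> 1 <= int_norm R x.
Proof.
move=> x0; have [[i j] xij] : exists ij, x ij.1 ij.2 != 0.
  apply/existsP; rewrite -negb_forall; apply: contra x0 => /forallP x0.
  by apply/eqP/matrixP => i j; rewrite mxE; apply/eqP; exact: (x0 (i, j)).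
apply: le_trans (int_norm_entry R x i j); rewrite -intr_norm ler1z.
by move: xij => /=; lia.
Qed.

Lemma nonprimitive_dvd n (x : 'M[int]_n) : x != 0 -> ~ primitive x ->
  exists d : nat, (2 <= d)%N /\ exists y, x = d%:Z *: y.
Proof.
move=> x0 /existsNP[d /not_implyP[dx d1]]; exists d.
have xE : x = d%:Z *: (\matrix_(i, j) (x i j %/ d)%Z).
  by apply/matrixP => i j; rewrite !mxE mulrC divzK.
split; last by eexists; exact: xE.
case: d dx d1 xE => [|[|d]] // _ _ xE.
by move: x0; rewrite xE scale0r eqxx.
Qed.

(** A nonzero nonprimitive matrix of the ball is d y with d >= 2 and y in the ball of radius H / d.
    As y has norm at least 1, d <= H < D. The summand 1 accounts for the zero matrix. *)
Lemma ncard_lattice_ball_primitive (R : realType) n (H : R) (D : nat) :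
  H < D%:R ->
  (ncard (lattice_ball n H) <= ncard (primitive_ball n H) + 1 +
     \sum_(d < D | (2 <= d)%N) ncard (lattice_ball n (H / d%:R)))%N.
Proof.
move=> HD.
pose F (d : nat) : set 'M[int]_n :=
  if (2 <= d)%N then (fun y => d%:Z *: y) @` lattice_ball n (H / d%:R) else set0.
have finF d : finite_set (F d).
  by rewrite /F; case: ifP => _ //; apply/finite_image/finite_lattice_ball.
have finU : finite_set (\big[setU/set0]_(d < D) F d).
  exact: finite_bigsetU.
have finP := finite_primitive_ball n H.
have fin0 := finite_set1 (0 : 'M[int]_n).
apply: (@leq_trans (ncard ((primitive_ball n H `|` [set 0]) `|` \big[setU/set0]_(d < D) F d))).
  apply: ncard_sub; first by rewrite !finite_setU.
  move=> x xH; have [->|x0] := eqVneq x 0; first by left; right.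
  have [px|npx] := pselect (primitive x); first by left; left.
  right; have [d [d2 [y xE]]] := nonprimitive_dvd x0 npx.
  have d0 : 0 < d%:R :> R by rewrite ltr0n; lia.
  have nx : int_norm R x = d%:R * int_norm R y.
    by rewrite xE int_normZ ger0_norm // ler0z.
  have y0 : y != 0 by apply: contra x0 => /eqP y0; rewrite xE y0 scaler0.
  have dD : (d < D)%N.
    rewrite -(ltr_nat R); apply: le_lt_trans HD.
    by apply: le_trans xH; rewrite nx ler_peMr // int_norm_ge1.
  apply: (@sub_bigsetU _ _ (fun d : 'I_D => F d) (Ordinal dD)).
  rewrite /F /= d2; exists y; last by rewrite xE.
  by rewrite /lattice_ball /= ler_pdivlMr // mulrC -nx.
apply: leq_trans (ncardU _ _) _ => //; first by rewrite finite_setU.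
apply: leq_add.
  by apply: leq_trans (ncardU _ _) _ => //; rewrite ncard_set1.
apply: leq_trans (ncard_bigsetU _) _ => //.
rewrite [leqRHS]big_mkcond /=; apply: leq_sum => d _; rewrite /F; case: ifP => _.
  exact/ncard_image/finite_lattice_ball.
by rewrite /ncard fset_set0.
Qed.

(** Dilating the small ball by d lands in radius H + d n = l H, and [ncard_lattice_ball_scale]
    returns to H; dividing by d ^ (n * n) turns l into 1 / d + n / H. *)
Lemma ncard_lattice_ball_div (R : realType) (n d : nat) (H : R) :
  (2 <= n)%N -> n%:R ^+ 60 <= H -> (0 < d)%N ->
  (ncard (lattice_ball n (H / d%:R)))%:R <=
    1001 / 1000 * (d%:R^-1 + n%:R / H) ^+ (n * n) * (ncard (lattice_ball n H))%:R.
Proof.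
move=> n2 nH d0.
have H0 : 0 < H by apply: lt_le_trans nH; rewrite exprn_gt0 // ltr0n; lia.
have dR0 : 0 < d%:R :> R by rewrite ltr0n.
pose l : R := 1 + d%:R * n%:R / H.
have l1 : 1 <= l by rewrite lerDl divr_ge0 ?mulr_ge0 // ltW.
have := ncard_lattice_ball_scale n2 nH l1.
have := @mul_ncard_lattice_ball R n d (H / d%:R) d0.
have -> : d%:R * (H / d%:R + n%:R) = l * H by rewrite /l; field; rewrite !gt_eqF.
rewrite -(ler_nat R) natrM natrX => e1 e2.
have lE : l = d%:R * (d%:R^-1 + n%:R / H) by rewrite /l; field; rewrite !gt_eqF.
have dN0 : 0 < d%:R ^+ (n * n) :> R by rewrite exprn_gt0.
rewrite -(ler_pM2l dN0); apply: le_trans (le_trans e1 e2) _; rewrite lE exprMn.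
by rewrite le_eqVlt; apply/orP; left; apply/eqP; ring.
Qed.

(** The sum telescopes, since 1 / (d (d - 1)) = 1 / (d - 1) - 1 / d. *)
Lemma sum_inv_square_le (R : realType) (D : nat) :
  \sum_(d < D | (3 <= d)%N) (d%:R * (d%:R - 1))^-1 <= 2^-1 :> R.
Proof.
case: D => [|[|[|D]]]; do ?by rewrite big1 // => -[[|[|[|d]]]].
suff -> : \sum_(d < D.+3 | (3 <= d)%N) (d%:R * (d%:R - 1))^-1 =
    2^-1 - (D%:R + 2)^-1 :> R by rewrite gerBl.
elim: D => [|D IH]; first by rewrite big1 ?add0r ?subrr // => -[[|[|[|d]]]].
rewrite big_mkcond big_ord_recr /= -big_mkcond IH -!natr1.
have : 0 <= D%:R :> R by []; move: (D%:R : R) => v v0.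
by field; rewrite !gt_eqF //; lra.
Qed.

(** The proper multiples take a share of at most 1.001 * 0.12 of the ball and the zero matrix at
    most 1 / 2000, which leaves more than 0.879. *)
Lemma ncard_primitive_ball_ge (R : realType) (n : nat) (H : R) :
  (2 <= n)%N -> n%:R ^+ 60 <= H ->
  879 / 1000 * (ncard (lattice_ball n H))%:R <= (ncard (primitive_ball n H))%:R :> R.
Proof.
move=> n2 nH.
have v2 : 2 <= n%:R :> R by rewrite (ler_nat _ 2).
set B : R := (ncard (lattice_ball n H))%:R.
have H_big : 10 ^+ 6 * n%:R ^+ 2 <= H.
  apply: le_trans nH; rewrite (exprD _ 58 2) ler_wpM2r ?exprn_ge0 //.
  apply: (@le_trans _ _ (2 ^+ 58)); first by lra.
  by rewrite lerXn2r ?nnegrE //; lra.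
have H_gt0 : 0 < H by apply: lt_le_trans H_big; nra.
have N4 : (4 <= n * n)%N by nia.
pose e : R := n%:R / H.
have e_ge0 : 0 <= e by rewrite divr_ge0 // ltW.
have He : H * e = n%:R by rewrite /e; field; rewrite gt_eqF.
have e_small : (n%:R + 2) * e <= 10 ^- 5.
  rewrite /e mulrA ler_pdivrMr //; nra.
have e_le : e <= 10 ^- 5.
  by apply: le_trans e_small; rewrite ler_peMl //; lra.
pose D := (Num.truncn H).+1.
have HD : H < D%:R by exact: truncnS_gt.
(* Dilating the ball of radius 0 by 8 already gives 8 ^ (n * n) >= 4096 points. *)
have B_big : 2000 <= B.
  have h : 8%:R * (0 + n%:R) <= H by nra.
  have := leq_trans (@mul_ncard_lattice_ball R n 8 0 isT) (ncard_lattice_ball_mono _ h).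
  rewrite -(ler_nat R) -/B natrM; apply: le_trans.
  have : 1 <= (ncard (lattice_ball n (0 : R)))%:R :> R.
    rewrite ler1n -[X in (X <= _)%N](@ncard_set1 'M[int]_n 0).
    apply: ncard_sub; first exact: finite_lattice_ball.
    move=> _ ->; rewrite /lattice_ball /= /int_norm map_mx0.
    by rewrite (eqP (_ : frobenius_norm 0 == 0)) // frobenius_norm_eq0.
  have : 8 ^+ 4 <= (8 ^ (n * n))%:R :> R by rewrite natrX ler_eXn2l //; lra.
  nra.
(* Since 1 / d + e <= 1 and n * n >= 4, the exponent may be lowered to 4. *)
have term (d : 'I_D) : (2 <= d)%N -> (ncard (lattice_ball n (H / d%:R)))%:R <=
    1001 / 1000 * (d%:R^-1 + e) ^+ 4 * B.
  move=> d2; apply: le_trans (ncard_lattice_ball_div n2 nH (ltnW d2)) _.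
  apply: ler_wpM2r; first exact: ler0n.
  apply: ler_wpM2l; first by clear; lra.
  have id0 : 0 <= d%:R^-1 :> R by rewrite invr_ge0 ler0n.
  have id2 : d%:R^-1 <= 2^-1 :> R.
    by rewrite lef_pV2 ?posrE ?ltr0n ?(ler_nat _ 2) // (ltnW d2).
  by rewrite -/e; apply: ler_wiXn2l => //; clear -id0 id2 e_ge0 e_le; lra.
have dH (d : 'I_D) : d%:R <= H.
  by rewrite -truncn_ge_nat ?ltW // -ltnS.
have term2 : (2^-1 + e) ^+ 4 <= 64 / 1000.
  have t0 : 0 <= (2^-1 + e) ^+ 2 by exact: sqr_ge0.
  have t1 : (2^-1 + e) ^+ 2 <= 252 / 1000.
    by rewrite expr2; clear -e_ge0 e_le; nra.
  rewrite (exprM _ 2 2) [leLHS]expr2.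
  by apply: le_trans (ler_pM t0 t0 t1 t1) _; clear; lra.
have term3 (d : 'I_D) : (3 <= d)%N ->
    (d%:R^-1 + e) ^+ 4 <= 112 / 1000 * (d%:R * (d%:R - 1))^-1.
  move=> d3; have := dH d; have : 3 <= d%:R :> R by rewrite (ler_nat _ 3).
  move: (d%:R : R) => x x3 xH.
  have x0 : 0 < x by clear -x3; lra.
  have ex : e * x <= n%:R by rewrite -He mulrC ler_wpM2r.
  have -> : x^-1 + e = (1 + e * x) / x by field; rewrite gt_eqF.
  rewrite expr_div_n ler_pdivrMr ?exprn_gt0 //.
  (* From e x <= n the square is at most 1 + (n + 2) e x, where 1 <= x / 3 and (n + 2) e is tiny.
     Squaring again, 0.334^2 < 0.112. *)
  have s : (1 + e * x) ^+ 2 <= 334 / 1000 * x.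
    have : e * x * (e * x) <= n%:R * (e * x).
      by apply: ler_wpM2r ex; apply: mulr_ge0 => //; exact: ltW.
    by clear -x3 e_small ex e_ge0; nra.
  have s0 : 0 <= (1 + e * x) ^+ 2 by exact: sqr_ge0.
  rewrite -[leRHS]mulrA.
  apply: (@le_trans _ _ (112 / 1000 * x ^+ 2)).
    by rewrite (exprM _ 2 2); clear -s s0 x0; nra.
  apply: ler_wpM2l; first by clear; lra.
  have xx_gt0 : 0 < x * (x - 1) by apply: mulr_gt0; clear -x3; lra.
  rewrite mulrC ler_pdivlMr //.
  have -> : x ^+ 4 = x ^+ 2 * (x * x) by ring.
  apply: ler_wpM2l; first exact: sqr_ge0.
  by apply: ler_wpM2l; clear -x0; lra.
have := ncard_lattice_ball_primitive n HD; rewrite -(ler_nat R) !natrD -/B natr_sum.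
move=> main.
have : \sum_(d < D | (2 <= d)%N) (ncard (lattice_ball n (H / d%:R)))%:R <=
   1001 / 1000 * (120 / 1000) * B.
  apply: le_trans (ler_sum _ (fun d h => term d h)) _.
  rewrite -mulr_suml; apply: ler_wpM2r; first exact: ler0n.
  rewrite -mulr_sumr; apply: ler_wpM2l; first lra.
  have D2 : (2 < D)%N by rewrite -(ltr_nat R); apply: le_lt_trans HD; clear -H_big v2; nra.
  rewrite (bigD1 (Ordinal D2)) //=.
  (* The term d = 2 is about 1 / 16; the terms d >= 3 are dominated by the telescoping series, of
     sum at most 1 / 2. *)
  rewrite (_ : 120 / 1000 = 64 / 1000 + 112 / 1000 * 2^-1); last by clear; lra.
  apply: lerD; first exact: term2.
  apply: le_trans (_ : _ <= 112 / 1000 *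
    \sum_(d < D | (3 <= d)%N) (d%:R * (d%:R - 1))^-1) _; last first.
    by apply: ler_wpM2l; [clear; lra|exact: sum_inv_square_le].
  rewrite mulr_sumr.
  rewrite (eq_bigl (fun d : 'I_D => (3 <= d)%N)); last first.
    by move=> d; rewrite -val_eqE /= [RHS]ltn_neqAle andbC [2%N == _]eq_sym.
  by apply: ler_sum => d; exact: term3.
by clear -main B_big; lra.
Qed.

(** * Slabs *)

Section Dot.
Variables (R : realType) (n : nat).
Implicit Types (u v : 'I_n -> R).

Definition dot u v : R := \sum_i u i * v i.

Lemma dot_cauchy_schwarz u v : `|dot u v| <= Num.sqrt (dot u u) * Num.sqrt (dot v v).
Proof.
rewrite -sqrtrM ?sumr_ge0 // => [|i _]; last by rewrite -expr2 sqr_ge0.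
rewrite -sqrtr_sqr ler_sqrt; last by apply: mulr_ge0; apply: sumr_ge0 => i _; rewrite -expr2 sqr_ge0.
by apply: le_trans (sum_cauchy_schwarz _ _) _; rewrite /dot; under eq_bigr do rewrite expr2;
  under [X in _ * X <= _]eq_bigr do rewrite expr2.
Qed.

Lemma exists_unit_normal (A : 'M[R]_n) (i : 'I_n) :
  exists u, dot u u = 1 /\ forall j, j != i -> dot u (fun k => A k j) = 0.
Proof.
(* Erasing column i makes the matrix singular; a nonzero vector of its left kernel, normalized, is
   orthogonal to the remaining columns. *)
pose B := \matrix_(j, k) (if k == i then 0 else A j k).
have Bsing : \det B = 0.
  rewrite (expand_det_col _ i) big1 // => j _; by rewrite mxE eqxx mul0r.
have /det0P[w w0 wB] := introT eqP Bsing.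
pose u k := w 0 k.
have uu : 0 < dot u u.
  rewrite lt_def sumr_ge0 ?andbT; last by move=> k _; rewrite -expr2 sqr_ge0.
  apply: contra w0; rewrite psumr_eq0; last by move=> k _; rewrite -expr2 sqr_ge0.
  move=> /allP u0; apply/eqP/rowP => k; rewrite mxE.
  by have := u0 k (mem_index_enum _); rewrite mulf_eq0 orbb => /eqP.
exists (fun k => u k / Num.sqrt (dot u u)); split.
  rewrite /dot; under eq_bigr => k _ do rewrite mulrACA -expr2 -invfM -expr2.
  rewrite sqr_sqrtr ?ltW // -mulr_suml.
  by under eq_bigr do rewrite expr2; rewrite divff ?gt_eqF.
move=> j ji; rewrite /dot; under eq_bigr => k _ do rewrite mulrAC.
rewrite -mulr_suml; apply/eqP; rewrite mulf_eq0; apply/orP; left.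
have /rowP/(_ j) := wB; rewrite !mxE => wBj; apply/eqP; rewrite -[RHS]wBj; apply: eq_bigr => k _.
by rewrite mxE (negbTE ji).
Qed.

End Dot.

Section Slab.
Variables (R : realType) (n : nat) (i : 'I_n).
Implicit Types (x y : 'M[int]_n) (k : int).

Definition int_col x (j : 'I_n) : 'I_n -> R := fun a => (x a j)%:~R.

(* Only the columns other than i enter the set from which the normal is picked,
   so the normal does not change when column i does. *)
Definition unit_normal x : 'I_n -> R :=
  xget (fun=> 0) [set u | dot u u = 1 /\ forall j, j != i -> dot u (int_col x j) = 0].

(** The signed distance of column i from the hyperplane orthogonal to the normal, which contains all
    the other columns. *)
Definition signed_dist x : R := dot (unit_normal x) (int_col x i).

(** The normal varies with x; only for fixed columns other than i is this an actual slab, in the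
    space of column i. *)
Definition slab (e r : R) : set 'M[int]_n :=
  [set x | lattice_ball n r x /\ `|signed_dist x| <= e].

Lemma unit_normalP x : dot (unit_normal x) (unit_normal x) = 1 /\
  forall j, j != i -> dot (unit_normal x) (int_col x j) = 0.
Proof.
rewrite /unit_normal; case: xgetP => [u _ //|h]; exfalso.
have [u [uu uj]] := exists_unit_normal (map_mx intr x : 'M[R]_n) i.
apply: (h u); split=> // j ji; rewrite -[RHS](uj j ji); congr dot.
by apply/funext => a; rewrite mxE.
Qed.

Lemma eq_unit_normal x y : (forall a j, j != i -> x a j = y a j) ->
  unit_normal x = unit_normal y.
Proof.
move=> xy; rewrite /unit_normal; congr xget; apply/funext => u; apply/propext.
have e j : j != i -> int_col x j = int_col y j.
  by move=> ji; apply/funext => a; rewrite /int_col xy.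
by split=> -[uu uj]; split=> // j ji; have := uj j ji; rewrite e.
Qed.

(** Column i moves by k times the normal, rounded down entrywise to remain integral. *)
Definition shift x k : 'M[int]_n :=
  \matrix_(a, j) (x a j + (if j == i then Num.floor (k%:~R * unit_normal x a) else 0)).

Lemma unit_normal_shift x k : unit_normal (shift x k) = unit_normal x.
Proof. by apply: eq_unit_normal => a j /negbTE ji; rewrite mxE ji addr0. Qed.

(** Without rounding, the distance would change by exactly k, the normal being a unit vector. The
    rounding error has norm at most sqrt n, bounded here by n. *)
Lemma signed_dist_shift x k :
  `|signed_dist (shift x k) - (signed_dist x + k%:~R)| <= n%:R.
Proof.
rewrite /signed_dist unit_normal_shift; set u := unit_normal x.
have [uu _] := unit_normalP x; rewrite -/u in uu.
pose err a : R := (Num.floor (k%:~R * u a))%:~R - k%:~R * u a.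
have -> : dot u (int_col (shift x k) i) - (dot u (int_col x i) + k%:~R) = dot u err.
  have kE : k%:~R = \sum_a k%:~R * (u a * u a) by rewrite -mulr_sumr -/(dot u u) uu mulr1.
  rewrite {1}kE /dot -big_split /= -sumrB; apply: eq_bigr => a _.
  by rewrite /int_col mxE eqxx intrD /err -/u; ring.
apply: le_trans (dot_cauchy_schwarz _ _) _; rewrite uu sqrtr1 mul1r.
have err1 a : err a ^+ 2 <= 1.
  have := ge_floor (k%:~R * u a); have := lt_succ_floor (k%:~R * u a).
  by rewrite intrD /err => *; nra.
have en : dot err err <= n%:R.
  rewrite /dot -[X in _ <= X%:R]card_ord -sumr_const; apply: ler_sum => a _.
  by rewrite -expr2.
apply: le_trans (_ : Num.sqrt (n%:R ^+ 2) <= _); last by rewrite sqrtr_sqr ger0_norm.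
rewrite ler_sqrt ?sqr_ge0 //; apply: le_trans en _.
by rewrite expr2 -natrM ler_nat; case: (n) => // m; rewrite leq_pmull.
Qed.

(** Pythagoras: with s the signed distance, the unrounded translate has squared norm |x|^2 - s^2 +
    (s + k)^2 <= r^2 + L^2. Rounding adds at most n to the norm. *)
Lemma int_norm_shift x k (L r : R) : 0 <= r -> lattice_ball n r x ->
  `|signed_dist x + k%:~R| <= L ->
  lattice_ball n (Num.sqrt (r ^+ 2 + L ^+ 2) + n%:R) (shift x k).
Proof.
move=> r0 xr sL; rewrite /lattice_ball /= /int_norm.
have [uu _] := unit_normalP x; set u := unit_normal x in uu.
pose U : 'M[R]_n := \matrix_(a, j) (if j == i then u a else 0).
pose E : 'M[R]_n := \matrix_(a, j) (if j == i then
  (Num.floor (k%:~R * u a))%:~R - k%:~R * u a else 0).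
have -> : map_mx intr (shift x k) = (map_mx intr x + k%:~R *: U) + E.
  apply/matrixP => a j; rewrite !mxE intrD -/u; case: ifP => _; last by rewrite mulr0 !addr0.
  by ring.
apply: le_trans (frobenius_normD _ _) _; apply: lerD; last first.
  apply: frobenius_norm_le_dim => a j; rewrite mxE; case: ifP => _; last by rewrite normr0.
  have := ge_floor (k%:~R * u a); have := lt_succ_floor (k%:~R * u a).
  by rewrite intrD ler_norml => *; apply/andP; split; lra.
rewrite -(ger0_norm (frobenius_norm_ge0 _)) -sqrtr_sqr ler_sqrt ?addr_ge0 ?sqr_ge0 //.
rewrite sqr_frobenius_norm.
have -> : \sum_a \sum_j (map_mx intr x + k%:~R *: U) a j ^+ 2 =
   int_norm R x ^+ 2 + (k%:~R * signed_dist x) *+ 2 + k%:~R ^+ 2.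
  have h : \sum_a \sum_j (k%:~R * U a j * (x a j)%:~R) = k%:~R * signed_dist x.
    rewrite /signed_dist /dot mulr_sumr; apply: eq_bigr => a _.
    rewrite (bigD1 i) //= mxE eqxx big1 ?addr0 -?mulrA // => j /negbTE ji.
    by rewrite mxE ji mulr0 mul0r.
  have h' : \sum_a \sum_j (k%:~R * U a j) ^+ 2 = k%:~R ^+ 2.
    have -> : k%:~R ^+ 2 = \sum_a k%:~R ^+ 2 * (u a * u a).
      by rewrite -mulr_sumr -/(dot u u) uu mulr1.
    apply: eq_bigr => a _.
    rewrite (bigD1 i) //= mxE eqxx big1 ?addr0; first by rewrite exprMn -expr2.
    by move=> j /negbTE ji; rewrite mxE ji mulr0 expr0n.
  rewrite -h -h' /int_norm sqr_frobenius_norm -sumrMnl -!big_split /=; apply: eq_bigr => a _.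
  rewrite -sumrMnl -!big_split /=; apply: eq_bigr => j _.
  by rewrite !mxE; ring.
have h1 : int_norm R x ^+ 2 <= r ^+ 2 by rewrite lerXn2r ?nnegrE ?frobenius_norm_ge0.
have h2 : (signed_dist x + k%:~R) ^+ 2 <= L ^+ 2.
  by rewrite -real_normK ?num_real // lerXn2r ?nnegrE //; apply: le_trans sL.
have := sqr_ge0 (signed_dist x); nra.
Qed.

(* Translating the slab along its normal by all integers k for which it stays
   within distance L of the hyperplane covers no point more than 2 (e + n) + 1
   times and stays in a ball only slightly larger than the original one. *)
Lemma ncard_slab_le (e L r : R) : 0 <= e -> 0 <= L -> 0 <= r ->
  (ncard (slab e r) * Num.truncn (2 * L) <=
   ncard (lattice_ball n (Num.sqrt (r ^+ 2 + L ^+ 2) + n%:R)) *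
     (Num.truncn (2 * (e + n%:R))).+1)%N.
Proof.
move=> e0 L0 r0.
set m := Num.truncn (2 * L); set M := Num.truncn _.
pose E := e + n%:R.
have E0 : 0 <= E by rewrite addr_ge0.
(* The consecutive integers k from the least one with s + k >= - L, where s is the signed distance
   of x; as m <= 2 L, the first m of them all keep s + k <= L. *)
pose K x (j : 'I_m) : int := Num.ceil (- L - signed_dist x) + j%:Z.
(* For a translate y by k, the integer k is within E of the signed distance of y; its offset from
   the least such integer lies in [0, M] and labels the preimages of y. *)
pose c y k : int := k - Num.ceil (signed_dist y - E).
pose f x (j : 'I_m) : 'M[int]_n * 'I_M.+1 :=
  (shift x (K x j), inord (absz (c (shift x (K x j)) (K x j)))).
have K_bound x j : `|signed_dist x + (K x j)%:~R| <= L.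
  have jm : j.+1%:R <= 2 * L.
    by rewrite -truncn_ge_nat ?mulr_ge0 //; exact: ltn_ord.
  rewrite /K intrD -pmulrn ler_norml; move: jm; rewrite -natr1 => jm.
  have := ceil_ge (- L - signed_dist x); have := ceilB1_lt (- L - signed_dist x).
  rewrite intrB => h1 h2; have : 0 <= j%:R :> R by [].
  by move=> j0; apply/andP; split; lra.
have c_bound x j : `|signed_dist x| <= e ->
    0 <= c (shift x (K x j)) (K x j) <= M%:Z.
  move=> xe; set y := shift _ _; set k := K x j.
  have ky : `|signed_dist y - k%:~R| <= E.
    have := signed_dist_shift x k; rewrite -/y /E => h.
    rewrite (_ : _ - _ = (signed_dist y - (signed_dist x + k%:~R)) + signed_dist x); last by ring.
    by apply: le_trans (ler_normD _ _) _; rewrite addrC lerD.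
  move: ky; rewrite ler_norml => /andP[k1 k2].
  have c1 : Num.ceil (signed_dist y - E) <= k by rewrite ceil_le_int; lra.
  have c2 := ceil_ge (signed_dist y - E).
  rewrite /c subr_ge0 c1 /=.
  have : (absz (k - Num.ceil (signed_dist y - E)) <= M)%N.
    rewrite truncn_ge_nat ?mulr_ge0 //.
    rewrite natr_absz ger0_norm ?subr_ge0 // intrB -/E; lra.
  by move: c1; lia.
have := @ncard_inj _ _ _ _ (slab e r) (lattice_ball n (Num.sqrt (r ^+ 2 + L ^+ 2) + n%:R)) f.
rewrite !card_ord; apply; last 2 first.
- by move=> x j [xr _]; apply: int_norm_shift.
- move=> x j y l [_ xe] [_ ye] [exy /(congr1 val)] /=.
  have := c_bound x j xe; have := c_bound y l ye; rewrite -exy.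
  set z := shift x _ in exy *; move=> b1 b2.
  rewrite !inordK; [|lia|lia] => ec.
  have ek : K x j = K y l by move: ec b1 b2; rewrite /c; lia.
  (* The translate retains the normal, so it determines, together with k, the vector to subtract and
     hence x. *)
  have eu : unit_normal x = unit_normal y.
    by rewrite -(unit_normal_shift x (K x j)) -/z exy unit_normal_shift.
  have xy : x = y.
    apply/matrixP => a b; have /matrixP/(_ a b) := exy.
    by rewrite /z !mxE eu ek => /addIr.
  congr pair => //; apply: val_inj; move: ek; rewrite /K xy /=; lia.
- by apply: sub_finite_set (finite_lattice_ball n r) => x [].
- exact: finite_lattice_ball.
Qed.

End Slab.

(** * Condition number *)

Lemma operator_norm_bounds (R : realType) n (A : 'M[R]_n) (c : R) : (0 < n)%N ->
  (forall v : 'cV[R]_n, frobenius_norm v = 1 -> frobenius_norm (A *m v) <= c) ->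
  0 <= operator_norm A <= c.
Proof.
case: n A => // n A _ Ac.
pose S := [set frobenius_norm (A *m v) | v in [set v : 'cV[R]_n.+1 | frobenius_norm v = 1]].
have Sub : ubound S c by move=> _ [v /= v1 <-]; exact: Ac.
(* A unit vector exists since the dimension is positive, so the supremum is taken over a nonempty
   set. *)
have e1 : frobenius_norm (delta_mx 0 0 : 'cV[R]_n.+1) = 1.
  rewrite /frobenius_norm (bigD1 0) //= big_ord1 mxE eqxx expr1n big1 ?addr0 ?sqrtr1 //.
  by move=> j j0; rewrite big_ord1 mxE (negbTE j0) expr0n.
have Se : S (frobenius_norm (A *m (delta_mx 0 0 : 'cV_n.+1))).
  exact: (ex_intro2 _ _ _ e1 erefl).
apply/andP; split.
  by apply: le_trans (frobenius_norm_ge0 _) _; apply: ub_le_sup Se; exists c.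
by apply: ge_sup; [eexists; exact: Se|].
Qed.

Lemma frobenius_norm_mulmx (R : realType) n (A : 'M[R]_n) (v : 'cV[R]_n) :
  frobenius_norm (A *m v) <= frobenius_norm A * frobenius_norm v.
Proof.
rewrite -(@ler_sqr _ _) ?nnegrE ?mulr_ge0 ?frobenius_norm_ge0 //.
rewrite exprMn !sqr_frobenius_norm mulr_suml; apply: ler_sum => a _.
rewrite big_ord1 mxE; under [X in _ * X]eq_bigr do rewrite big_ord1.
exact: sum_cauchy_schwarz.
Qed.

(** As u_i kills every column except the i-th, pairing it with A v isolates v_i times the distance
    of column i, whence |v_i| D <= |A v|. Summing squares gives |v| D <= sqrt n |A v|: A is
    invertible and its inverse has norm at most sqrt n / D. *)
Lemma condition_number_lt (R : realType) n (A : 'M[R]_n) (u : 'I_n -> 'I_n -> R) (H t : R) :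
  (0 < n)%N -> 0 < t -> 0 < H -> frobenius_norm A <= H ->
  (forall i, dot (u i) (u i) = 1) ->
  (forall i j, j != i -> dot (u i) (fun a => A a j) = 0) ->
  (forall i, Num.sqrt n%:R * H / t < `|dot (u i) (fun a => A a i)|) ->
  (condition_number A < t%:E)%E.
Proof.
move=> n0 t0 H0 AH uu uA dist.
pose d i := `|dot (u i) (fun a => A a i)|.
(* Taking the least distance preserves the strict inequality that the conclusion needs. *)
have [D Dt Dd] : exists2 D, Num.sqrt n%:R * H / t < D & forall i, D <= d i.
  exists (d [arg min_(i < Ordinal n0) d i]%O); first exact: dist.
  by case: Order.TotalTheory.arg_minP => // i _ h j; exact: h.
have sn : 0 < Num.sqrt n%:R :> R by rewrite sqrtr_gt0 ltr0n.
have D0 : 0 < D by apply: lt_trans Dt; rewrite divr_gt0 ?mulr_gt0.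
have key (v : 'cV[R]_n) i : `|v i 0| * D <= frobenius_norm (A *m v).
  apply: (@le_trans _ _ (`|v i 0| * d i)); first by rewrite ler_wpM2l.
  rewrite /d -normrM.
  have -> : v i 0 * dot (u i) (fun a => A a i) = dot (u i) (fun a => (A *m v) a 0).
    have u0 j : j != i -> \sum_a u i a * (A a j * v j 0) = 0.
      move=> ji; have /(congr1 (fun z => z * v j 0)) := uA i j ji.
      rewrite mul0r mulr_suml => h; rewrite -[RHS]h.
      by apply: eq_bigr => a _; rewrite mulrA.
    rewrite /dot; under [RHS]eq_bigr => a _ do rewrite mxE mulr_sumr.
    rewrite exchange_big /= [RHS](bigD1 i) //= [X in _ + X]big1 // addr0 mulr_sumr.
    by apply: eq_bigr => a _; ring.
  apply: le_trans (dot_cauchy_schwarz _ _) _; rewrite uu sqrtr1 mul1r.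
  rewrite /frobenius_norm /dot; under [X in _ <= Num.sqrt X]eq_bigr do rewrite big_ord1 expr2.
  by [].
have key2 (v : 'cV[R]_n) : frobenius_norm v * D <= Num.sqrt n%:R * frobenius_norm (A *m v).
  rewrite -(@ler_sqr _ _) ?nnegrE; last 2 first.
  - by rewrite mulr_ge0 ?frobenius_norm_ge0 // ltW.
  - by rewrite mulr_ge0 ?frobenius_norm_ge0 // ltW.
  rewrite !exprMn (sqr_sqrtr (ler0n R n)) [frobenius_norm v ^+ 2]sqr_frobenius_norm.
  have -> : n%:R * frobenius_norm (A *m v) ^+ 2 = \sum_(i < n) frobenius_norm (A *m v) ^+ 2.
    by rewrite sumr_const card_ord mulr_natl.
  rewrite mulr_suml; apply: ler_sum => i _.
  rewrite big_ord1 -exprMn -[leLHS]real_normK ?num_real //.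
  by rewrite lerXn2r ?nnegrE ?frobenius_norm_ge0 // normrM (gtr0_norm D0) key.
have Au : A \in unitmx.
  rewrite unitmxE unitfE -det_tr; apply/det0P => -[w w0 wA].
  have Aw : A *m w^T = 0 by rewrite -[A]trmxK -trmx_mul wA trmx0.
  have := key2 w^T; rewrite Aw (eqP (_ : frobenius_norm 0 == 0)) ?frobenius_norm_eq0 //.
  rewrite mulr0 pmulr_lle0 // => w_le0.
  have : frobenius_norm w^T == 0 by rewrite eq_le w_le0 frobenius_norm_ge0.
  by rewrite frobenius_norm_eq0 trmx_eq0 (negbTE w0).
rewrite /condition_number Au lte_fin.
have /andP[a0 a1] : 0 <= operator_norm A <= H.
  apply: operator_norm_bounds => // v v1; apply: le_trans (frobenius_norm_mulmx _ _) _.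
  by rewrite v1 mulr1.
have /andP[b0 b1] : 0 <= operator_norm (invmx A) <= Num.sqrt n%:R / D.
  apply: operator_norm_bounds => // v v1; rewrite ler_pdivlMr //.
  by apply: le_trans (key2 _) _; rewrite mulmxA mulmxV // mul1mx v1 mulr1.
apply: (@le_lt_trans _ _ (Num.sqrt n%:R / D * H)); first exact: ler_pM.
by rewrite mulrAC ltr_pdivrMr // -ltr_pdivrMl // mulrC.
Qed.

(** * Height *)

Lemma prod_primes_logn (b m : nat) : (0 < b <= m)%N ->
  (\prod_(0 <= p < m.+1 | prime p) p ^ logn p b = b)%N.
Proof.
move=> /andP[b0 bm]; rewrite -[RHS](partnT b0) (widen_partn _ bm) big_mkcond /=.
by apply: eq_bigr => p _; case: ifP => // np; rewrite lognE np.
Qed.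

(** The product formula for the rationals: only primes up to the larger of numerator and denominator
    contribute, and their powers reassemble these two integers. *)
Lemma padic_abs_prod (R : realType) (c : rat) : c != 0 ->
  \big[*%R/1]_(p \in [set p : nat | prime p]) padic_abs R p c = `|ratr c|^-1.
Proof.
move=> c0; set a := absz (numq c); set b := absz (denq c).
have a0 : (0 < a)%N by rewrite absz_gt0 numq_eq0.
have b0 : (0 < b)%N by rewrite absz_gt0 denq_neq0.
have abs p : prime p -> padic_abs R p c = (p ^ logn p b)%:R / (p ^ logn p a)%:R.
  move=> pp; have p0 : p%:R != 0 :> R by rewrite pnatr_eq0 -lt0n prime_gt0.
  by rewrite /padic_abs (negbTE c0) expfzDr // -exprnN !natrX.
pose m := maxn a b.
pose r := [seq p <- index_iota 0 m.+1 | prime p].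
rewrite (@fsbigE _ _ _ _ _ r); first last.
- move=> p /= pp; rewrite mem_filter pp mem_index_iota /= -ltnNge ltnS => mp.
  by rewrite abs // !ltn_log0 ?divr1 //; lia.
- by move=> p /=; rewrite mem_filter => /andP[].
- by rewrite filter_uniq // iota_uniq.
rewrite big_filter_cond (eq_bigl prime); last first.
  move=> p; have -> : (p \in [set p : nat | prime p]) = prime p by apply/idP/idP; rewrite inE.
  exact: andbb.
rewrite (eq_bigr _ (fun p pp => abs p pp)) prodf_div -!natr_prod.
rewrite !prod_primes_logn; try by rewrite ?a0 ?b0 /m; lia.
have -> : ratr c = (numq c)%:~R / (denq c)%:~R :> R by [].
by rewrite normrM normfV invfM invrK mulrC /a /b !natr_absz !intr_norm.
Qed.

Lemma padic_abs_mul_int (R : realType) (p : nat) (c : rat) (m : int) :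
  prime p -> c != 0 -> m != 0 ->
  padic_abs R p (c * m%:~R) = padic_abs R p c / (p ^ logn p `|m|%N)%:R.
Proof.
move=> pp c0 m0; have cm0 : c * m%:~R != 0 by rewrite mulf_neq0 // intr_eq0.
rewrite /padic_abs (negbTE c0) (negbTE cm0).
have p0 : p%:R != 0 :> R by rewrite pnatr_eq0 -lt0n prime_gt0.
rewrite natrX exprnN -expfzDr //; congr (_ ^ _).
set x := c * _ in cm0 *.
(* Valuations are read off this integer identity, with no need to know how the product c m
   reduces. *)
have e : numq x * denq c = numq c * m * denq x.
  apply/eqP; rewrite -(eqr_int rat) !intrM !numqE /x; apply/eqP; ring.
have := congr1 (fun z : int => logn p `|z|%N) e; rewrite /= !abszM !lognM ?muln_gt0 ?absz_gt0 ?numq_eq0 ?denq_neq0 ?m0 ?c0 ?cm0 //.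
lia.
Qed.

(** Some entry of x is prime to p, so the largest p-adic absolute value among the entries of x is
    1. *)
Lemma padic_max_primitive (R : realType) (n p : nat) (x : 'M[int]_n) (c : rat) :
  prime p -> c != 0 -> primitive x ->
  padic_max R p (c *: map_mx intr x) = padic_abs R p c.
Proof.
move=> pp c0 px; rewrite /padic_max.
have pc0 : 0 <= padic_abs R p c by rewrite /padic_abs (negbTE c0) exprz_ge0.
have [i [j xij]] : exists i j, ~~ (p %| x i j)%Z.
  apply: contrapT => /forallNP h; have : p = 1%N.
    apply: px => i j; by apply: contrapT => /negP xij; apply: (h i); exists j.
  by move: pp => /[swap] ->.
apply/eqP; rewrite eq_le; apply/andP; split.
  apply: bigmax_le => // -[k l] _ /=; rewrite !mxE.
  have [->|x0] := eqVneq (x k l) 0; first by rewrite mulr0 {1}/padic_abs eqxx.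
  rewrite padic_abs_mul_int // ler_piMr // invf_le1 ?ltr0n ?expn_gt0 ?prime_gt0 //.
  by rewrite ler1n expn_gt0 prime_gt0.
apply: bigmax_sup (_ : _ <= _ (i, j)) => //=; rewrite !mxE.
have x0 : x i j != 0 by apply: contra xij => /eqP ->; rewrite dvdz0.
rewrite padic_abs_mul_int // (_ : logn p _ = 0%N) ?divr1 //.
by apply/eqP; rewrite -leqn0 leqNgt logn_gt0 mem_primes pp absz_gt0 x0.
Qed.

(** By the product formula the finite places cancel the factor |c| of the Frobenius norm. *)
Lemma height_primitive (R : realType) (n : nat) (x : 'M[int]_n) (c : rat) :
  c != 0 -> primitive x -> height R (c *: map_mx intr x) = int_norm R x.
Proof.
move=> c0 px; rewrite /height.
rewrite (eq_fsbigr (fun p => padic_abs R p c)); last first.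
  by move=> p; rewrite inE => pp; exact: padic_max_primitive.
rewrite padic_abs_prod // map_mxZ frobenius_normZ -map_mx_comp.
rewrite mulrAC divff ?mul1r ?normr_eq0 ?fmorph_eq0 //.
by congr frobenius_norm; apply/matrixP => i j; rewrite !mxE /= ratr_int.
Qed.

(** Multiply by the product D of all denominators, then divide by the gcd g of the resulting integer
    entries. *)
Lemma primitive_multiple n (M : 'M[rat]_n) : M != 0 ->
  exists x : 'M[int]_n, primitive x /\ exists c : rat, c != 0 /\ M = c *: map_mx intr x.
Proof.
move=> M0.
pose D := \prod_(ij : 'I_n * 'I_n) denq (M ij.1 ij.2).
have D0 : D != 0 by apply/prodf_neq0 => ij _; exact: denq_neq0.
pose y : 'M[int]_n := \matrix_(i, j)
  (numq (M i j) * \prod_(ij : 'I_n * 'I_n | ij != (i, j)) denq (M ij.1 ij.2)).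
have yE i j : (y i j)%:~R = D%:~R * M i j :> rat.
  have DE : D = denq (M i j) * \prod_(ij : 'I_n * 'I_n | ij != (i, j)) denq (M ij.1 ij.2).
    by rewrite /D (bigD1 (i, j)).
  by rewrite mxE DE !intrM numqE; ring.
pose g := \big[gcdn/0%N]_(ij : 'I_n * 'I_n) absz (y ij.1 ij.2).
have gy i j : (g %| absz (y i j))%N by apply: (biggcdn_inf (i, j)).
have y0 : exists ij : 'I_n * 'I_n, y ij.1 ij.2 != 0.
  apply/existsP; rewrite -negb_forall; apply: contra M0 => /forallP y0.
  apply/eqP/matrixP => i j; rewrite mxE; apply/eqP.
  have := yE i j; rewrite (eqP (y0 (i, j))) => /esym/eqP.
  by rewrite mulf_eq0 intr_eq0 (negbTE D0).
have g0 : (0 < g)%N.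
  have [[i j] /= yij] := y0; rewrite lt0n; apply: contra yij => /eqP g0.
  by have := gy i j; rewrite g0 dvd0n absz_eq0.
pose x : 'M[int]_n := \matrix_(i, j) (y i j %/ g%:Z)%Z.
have xE i j : x i j * g%:Z = y i j by rewrite mxE divzK // dvdzE; exact: gy.
exists x; split.
  move=> d dx; have : (d * g %| g)%N.
    apply/dvdn_biggcdP => -[i j] _ /=; rewrite -xE abszM.
    by apply: dvdn_mul => //; have := dx i j; rewrite dvdzE.
  by rewrite -{2}[g]mul1n dvdn_pmul2r // dvdn1 => /eqP.
have gr0 : g%:R != 0 :> rat by rewrite pnatr_eq0 -lt0n.
have Dr0 : D%:~R != 0 :> rat by rewrite intr_eq0.
exists (g%:R / D%:~R); split; first by rewrite mulf_neq0 ?invr_eq0.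
apply/matrixP => i j; apply: (mulfI Dr0).
rewrite mxE [map_mx _ _ _ _]mxE -yE -xE intrM -pmulrn mulrA.
by rewrite [D%:~R * _]mulrC divfK // mulrC.
Qed.

(** With c = a / b in lowest terms, b x = a y, so b divides every entry of y and a every entry of x;
    primitivity forces both to be 1 or -1. *)
Lemma primitive_colinear n (x y : 'M[int]_n) (c : rat) :
  primitive x -> primitive y -> map_mx intr x = c *: map_mx intr y -> x = y \/ x = - y.
Proof.
move=> px py /matrixP xy.
have e i j : x i j * denq c = numq c * y i j.
  apply/eqP; rewrite -(eqr_int rat) !intrM numqE; have := xy i j; rewrite !mxE => ->.
  by apply/eqP; ring.
have d1 : absz (denq c) = 1%N.
  apply: py => i j; have : (denq c %| numq c * y i j)%Z by rewrite -e dvdz_mull.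
  by rewrite Gauss_dvdzr // coprimez_sym; exact: coprime_num_den.
have n1 : absz (numq c) = 1%N.
  apply: px => i j; have : (numq c %| x i j * denq c)%Z by rewrite e dvdz_mulr.
  by rewrite Gauss_dvdzl //; exact: coprime_num_den.
have dE : denq c = 1 by have := denq_gt0 c; lia.
have [nE|nE] : numq c = 1 \/ numq c = -1 by lia.
  by left; apply/matrixP => i j; have := e i j; rewrite dE nE mulr1 mul1r.
by right; apply/matrixP => i j; rewrite mxE; have := e i j; rewrite dE nE mulr1 mulN1r.
Qed.

(** * Points and primitive matrices *)

Section Points.
Variables (R : realType) (n : nat).
Implicit Types (P : {vspace 'M[rat]_n}) (x : 'M[int]_n).

(** One of the two primitive matrices on the line P. Its sign is an arbitrary choice, so later
    statements treat x and - x together. *)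
Definition primitive_rep P : 'M[int]_n :=
  xget 0 [set x | primitive x /\ exists c : rat, c != 0 /\ vpick P = c *: map_mx intr x].

Lemma primitive_repP P : projective_space P -> primitive (primitive_rep P) /\
  exists c : rat, c != 0 /\ vpick P = c *: map_mx intr (primitive_rep P).
Proof.
move=> P1; have vP : vpick P != 0 by rewrite vpick0 -dimv_eq0 P1.
have [x px] := primitive_multiple vP.
exact: (@xgetPex _ 0 [set x | primitive x /\ exists c : rat, c != 0 /\ vpick P = c *: map_mx intr x]
  (ex_intro _ x px)).
Qed.

Lemma primitive_neq0 x : primitive x -> x != 0.
Proof.
move=> px; apply/eqP => x0.
by have : 0%N = 1%N by apply: px => i j; rewrite x0 mxE.
Qed.

Lemma map_intr_neq0 x : primitive x -> map_mx intr x != 0 :> 'M[rat]_n.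
Proof.
move=> /primitive_neq0; apply: contra => /eqP/matrixP x0.
by apply/eqP/matrixP => i j; have := x0 i j; rewrite !mxE => /eqP; rewrite intr_eq0 => /eqP.
Qed.

Lemma primitive_rep_line P : projective_space P ->
  P = <[map_mx intr (primitive_rep P)]>%VS.
Proof.
move=> P1; have [px [c [c0 vP]]] := primitive_repP P1.
apply/esym/eqP; rewrite eqEdim dim_vline (map_intr_neq0 px) P1 /= leqnn andbT.
by rewrite -memvE -[map_mx _ _](scalerK c0) -vP memvZ ?memv_pick.
Qed.

Lemma projective_line x : primitive x ->
  projective_space <[map_mx intr x : 'M[rat]_n]>%VS.
Proof. by move=> px; rewrite /projective_space /= dim_vline map_intr_neq0. Qed.

Lemma primitive_rep_lineN x : primitive x ->
  x = primitive_rep <[map_mx intr x : 'M[rat]_n]>%VS \/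
  x = - primitive_rep <[map_mx intr x : 'M[rat]_n]>%VS.
Proof.
move=> px; have P1 := projective_line px.
have [py _] := primitive_repP P1.
have : (map_mx intr x : 'M[rat]_n) \in <[map_mx intr (primitive_rep <[map_mx intr x : 'M[rat]_n]>%VS)]>%VS.
  by rewrite -primitive_rep_line // memv_line.
by move=> /vlineP[c /primitive_colinear]; apply.
Qed.

(** Here [expR (h * ln 2)] is 2 ^ h; bounded bit length becomes membership of a lattice ball. *)
Lemma bit_length_le P (h : R) : projective_space P ->
  (bit_length R P <= h) = (int_norm R (primitive_rep P) <= expR (h * ln 2)).
Proof.
move=> P1; have [px [c [c0 vP]]] := primitive_repP P1.
rewrite /bit_length vP height_primitive // /log2.
have ln2 : 0 < ln 2 :> R by rewrite ln_gt0 // ltr1n.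
have x0 : 0 < int_norm R (primitive_rep P).
  by apply: lt_le_trans (int_norm_ge1 R (primitive_neq0 px)).
by rewrite ler_pdivrMr // -(ler_expR (ln _) (h * _)) lnK.
Qed.

Lemma int_normN x : int_norm R (- x) = int_norm R x.
Proof. by rewrite -scaleN1r int_normZ rmorphN1 normrN1 mul1r. Qed.

Lemma points_primitive_ball P (h : R) : points_of_bit_length_le n h P ->
  primitive_ball n (expR (h * ln 2)) (primitive_rep P).
Proof.
move=> [P1 Ph]; split; last by have [] := primitive_repP P1.
by rewrite /lattice_ball /= -bit_length_le.
Qed.

Lemma finite_points (h : R) : finite_set (points_of_bit_length_le n h).
Proof.
apply: (@sub_finite_set _ _ ((fun x => <[map_mx intr x : 'M[rat]_n]>%VS) @`
  primitive_ball n (expR (h * ln 2)))); last exact/finite_image/finite_primitive_ball.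
move=> P Ph; exists (primitive_rep P); first exact: points_primitive_ball.
by rewrite -primitive_rep_line //; case: Ph.
Qed.

(** A primitive matrix is recovered from its line and one bit, telling whether it is the chosen
    representative or its negative. *)
Lemma ncard_primitive_ball_le (h : R) :
  (ncard (primitive_ball n (expR (h * ln 2))) <=
   2 * ncard (points_of_bit_length_le n h))%N.
Proof.
pose L x := <[map_mx intr x : 'M[rat]_n]>%VS.
have := @ncard_inj _ _ unit bool _ _ (fun x _ => (L x, x == primitive_rep (L x)))
  (finite_primitive_ball n (expR (h * ln 2))) (finite_points h).
rewrite card_unit card_bool muln1 mulnC; apply=> [x _ [xH px]|x [] y [] [_ px] [_ py] e].
  split; first exact: projective_line.
  rewrite /= bit_length_le; last exact: projective_line.
  have e := primitive_rep_lineN px; move: xH; rewrite /lattice_ball /=.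
  by rewrite -/(L x) in e *; case: e => {1}->; rewrite ?int_normN.
have Lxy : L x = L y := congr1 fst e.
have : (x == primitive_rep (L x)) = (y == primitive_rep (L y)) := congr1 snd e.
rewrite Lxy => exy; congr pair.
have := primitive_rep_lineN px; have := primitive_rep_lineN py.
rewrite -/(L x) -/(L y) Lxy; move: (primitive_rep (L y)) exy => z exy.
move=> [yz|yz] [xz|xz].
- by rewrite xz yz.
- by move: exy; rewrite yz eqxx => /eqP ->.
- by move: exy; rewrite xz eqxx => /esym/eqP ->.
- by rewrite xz yz.
Qed.

(** Each point outside [E] contributes two distinct matrices x and - x to [B]. The factor 2 cancels
    the one in [ncard_primitive_ball_le]. *)
Lemma ncard_points_le (h : R) (E : set {vspace 'M[rat]_n}) (B : set 'M[int]_n) :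
  finite_set B ->
  (forall P x, points_of_bit_length_le n h P -> ~ E P ->
     x = primitive_rep P \/ x = - primitive_rep P -> B x) ->
  (2 * ncard (points_of_bit_length_le n h `\` E) <= ncard B)%N.
Proof.
move=> finB EB.
have := @ncard_inj _ _ bool unit _ _
  (fun P (b : bool) => ((if b then primitive_rep P else - primitive_rep P), tt))
  (finite_setD E (finite_points h)) finB.
rewrite card_unit card_bool muln1 mulnC; apply=> [P b [Ph PE]|P b Q c [[P1 _] _] [[Q1 _] _] /(congr1 fst) /= ePQ].
  by apply: EB Ph PE _ => /=; case: b; [left|right].
have lN x : <[map_mx intr (- x) : 'M[rat]_n]>%VS = <[map_mx intr x]>%VS.
  apply/eqP; rewrite eqEsubv -!memvE map_mxN memvN memv_line /=.
  by rewrite -[X in X \in _]opprK memvN memv_line.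
have lE (s : bool) x : <[map_mx intr (if s then x else - x) : 'M[rat]_n]>%VS = <[map_mx intr x]>%VS.
  by case: s; rewrite ?lN.
have PQ : P = Q.
  by rewrite (primitive_rep_line P1) (primitive_rep_line Q1) -(lE b) ePQ lE.
rewrite -PQ in ePQ *; congr pair.
have [/primitive_neq0 p0 _] := primitive_repP P1.
have pN : primitive_rep P <> - primitive_rep P.
  move=> e; case/eqP: p0; apply/matrixP => i j; rewrite mxE.
  have /matrixP/(_ i j) := e; rewrite mxE; move: (primitive_rep P i j) => z; lia.
by case: b c ePQ => -[] //= e; case: pN.
Qed.

(** The representative [vpick P] is a multiple r x, and the factor |r| scales the norm bound and all
    the distances alike. *)
Lemma point_condition_number_lt P x (H t : R) : (0 < n)%N -> 0 < t -> 0 < H ->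
  projective_space P -> x = primitive_rep P \/ x = - primitive_rep P ->
  int_norm R x <= H ->
  (forall i, Num.sqrt n%:R * H / t < `|signed_dist R i x|) ->
  (point_condition_number R P < t%:E)%E.
Proof.
move=> n0 t0 H0 P1 xP xH dist.
have [px [c [c0 vP]]] := primitive_repP P1.
have [d [d0 vPE]] : exists d : rat, d != 0 /\ vpick P = d *: map_mx intr x.
  case: xP => ->; first by exists c.
  exists (- c); split; first by rewrite oppr_eq0.
  by rewrite vP map_mxN scalerN scaleNr opprK.
pose r : R := ratr d.
have r0 : 0 < `|r| by rewrite normr_gt0 fmorph_eq0.
rewrite /point_condition_number.
have -> : map_mx ratr (vpick P) = r *: map_mx intr x :> 'M[R]_n.
  by rewrite vPE map_mxZ -map_mx_comp; congr (_ *: _); apply/matrixP => i j; rewrite !mxE /= ratr_int.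
have dotZ i j : dot (unit_normal R i x) (fun a => (r *: map_mx intr x : 'M[R]_n) a j) =
    r * dot (unit_normal R i x) (int_col R x j).
  by rewrite /dot mulr_sumr; apply: eq_bigr => a _; rewrite !mxE /int_col; ring.
apply: (@condition_number_lt _ _ _ (fun i => unit_normal R i x) (`|r| * H)) => //.
- by rewrite mulr_gt0.
- by rewrite frobenius_normZ ler_wpM2l.
- by move=> i; case: (unit_normalP R i x).
- by move=> i j ji; rewrite dotZ; case: (unit_normalP R i x) => _ -> //; rewrite mulr0.
- move=> i; rewrite dotZ (normrM r) -/(signed_dist R i x).
  have -> : Num.sqrt n%:R * (`|r| * H) / t = `|r| * (Num.sqrt n%:R * H / t) by ring.
  by rewrite ltr_pM2l.
Qed.

End Points.

(** * The main estimate *)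

(** The power is at most e, and e <= (6 / 5)^6 < 3 because exp (- 1 / 6) >= 5 / 6. *)
Lemma expr_1D_inv_le3 (R : realType) (k : nat) : (1 + k%:R^-1) ^+ k <= 3 :> R.
Proof.
case: k => [|k]; first by rewrite expr0; lra.
have e6 : expR (6^-1) <= 6 / 5 :> R.
  have h : 5 / 6 <= expR (- 6^-1) :> R by apply: le_trans (expR_ge1Dx _); lra.
  rewrite -[6^-1]opprK expRN -[leRHS]invf_div lef_pV2 ?posrE ?expR_gt0 //; lra.
apply: (@le_trans _ _ (expR (k.+1%:R * k.+1%:R^-1))).
  by rewrite expRM_natl lerXn2r ?nnegrE ?expR_ge0 ?addr_ge0 ?invr_ge0 // expR_ge1Dx.
have -> : k.+1%:R * k.+1%:R^-1 = 6%:R * 6^-1 :> R by rewrite !divff ?pnatr_eq0.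
rewrite expRM_natl; apply: (@le_trans _ _ ((6 / 5) ^+ 6)); last lra.
by apply: lerXn2r e6; rewrite nnegrE ?expR_ge0 //; lra.
Qed.

(** Spreading a slab of half-width e = H / (w n^2) to half-width L = H / n gains a factor L / e = w
    n, while the ball grows by a factor of about sqrt 3 at most; 1.74 absorbs all errors. *)
Lemma ncard_slab_fraction (R : realType) (n : nat) (i : 'I_n) (H w : R) :
  (2 <= n)%N -> 1 <= w -> w * n%:R ^+ 60 <= H ->
  n%:R * (ncard (slab i (H / (w * n%:R ^+ 2)) H))%:R <=
    174 / 100 / w * (ncard (lattice_ball n H))%:R.
Proof.
move=> n2 w1 wH.
have v2 : 2 <= n%:R :> R by rewrite (ler_nat _ 2).
have v60 : 10 ^+ 6 * n%:R ^+ 4 <= n%:R ^+ 60 :> R.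
  rewrite (exprD _ 56 4); apply: ler_wpM2r; first exact/exprn_ge0/ler0n.
  apply: (@le_trans _ _ (2 ^+ 56)); first by lra.
  by apply: lerXn2r => //; rewrite nnegrE; lra.
have v60_ge0 : 0 <= n%:R ^+ 60 :> R by exact/exprn_ge0/ler0n.
have nH : n%:R ^+ 60 <= H by apply: le_trans wH; rewrite ler_peMl.
have v4 : 0 <= n%:R ^+ 4 :> R by exact/exprn_ge0/ler0n.
have wHb : 10 ^+ 6 * (w * n%:R ^+ 4) <= H.
  apply: le_trans wH; rewrite mulrCA; apply: ler_wpM2l => //; lra.
have Hb : 10 ^+ 6 * n%:R ^+ 4 <= H := le_trans v60 nH.
set B : R := (ncard (lattice_ball n H))%:R.
have scale := fun l => @ncard_lattice_ball_scale R n H l n2 nH.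
clear wH v60 v60_ge0 nH.
have v8 : 8 <= n%:R ^+ 3 :> R.
  apply: (@le_trans _ _ (2 ^+ 3)); first by lra.
  by apply: lerXn2r => //; rewrite nnegrE; lra.
have v43 : n%:R ^+ 4 = n%:R * n%:R ^+ 3 :> R by rewrite -exprS.
have v3 : n%:R ^+ 3 = n%:R * n%:R ^+ 2 :> R by rewrite -exprS.
have v22 : n%:R ^+ 2 = n%:R * n%:R :> R by rewrite expr2.
have H_gt0 : 0 < H by apply: lt_le_trans Hb; rewrite v43; nra.
set e := H / _; pose L := H / n%:R.
have w0 : 0 < w by lra.
have v0 : 0 < n%:R :> R by lra.
have L0 : 0 < L by rewrite divr_gt0.
have e0 : 0 <= e by rewrite divr_ge0 ?mulr_ge0 ?exprn_ge0 // ltW.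
have := @ncard_slab_le R n i e L H e0 (ltW L0) (ltW H_gt0).
set m := Num.truncn (2 * L); set M := Num.truncn _; set S := ncard (slab i e H).
set C := ncard _ => main.
(* The choice of L makes sqrt (H^2 + L^2) = s H, and s ^ (n * n) is the square root of (1 + 1 /
   n^2)^(n^2), hence at most sqrt 3 < 1.733. *)
pose s : R := Num.sqrt (1 + (n * n)%:R^-1).
have s_ge1 : 1 <= s.
  by rewrite -{1}sqrtr1 ler_sqrt ?lerDl ?invr_ge0 // addr_ge0 ?invr_ge0.
pose l := s * (1 + n%:R / H).
have nH0 : 0 <= n%:R / H by rewrite divr_ge0 // ltW.
have l1 : 1 <= l by rewrite /l; nra.
have CB : C%:R <= 1001 / 1000 * l ^+ (n * n) * B.
  apply: le_trans (scale l l1); rewrite ler_nat; apply: ncard_lattice_ball_mono.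
  have -> : Num.sqrt (H ^+ 2 + L ^+ 2) = s * H.
    rewrite -{2}(gtr0_norm H_gt0) -sqrtr_sqr -sqrtrM ?addr_ge0 ?invr_ge0 //.
    by congr Num.sqrt; rewrite /L natrM; field; rewrite gt_eqF.
  have -> : l * H = s * H + s * n%:R by rewrite /l; field; rewrite gt_eqF.
  by rewrite lerD2l ler_peMl // ltW.
have sN : s ^+ (n * n) <= 1733 / 1000.
  have h0 : 0 <= s ^+ (n * n) by exact/exprn_ge0/sqrtr_ge0.
  have : (s ^+ (n * n)) ^+ 2 <= 3.
    rewrite exprAC sqr_sqrtr; first exact: expr_1D_inv_le3.
    by rewrite addr_ge0 ?invr_ge0.
  rewrite expr2; move: (s ^+ (n * n)) h0 => z z0 zz.
  by clear -z0 zz; nra.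
have dN : (1 + n%:R / H) ^+ (n * n) <= 1001 / 1000.
  have := expr1D_le (n * n) nH0.
  have : (n * n)%:R * (n%:R / H) <= 1 / 10 ^+ 6.
    rewrite natrM mulrA ler_pdivrMr // -mulrA -v22 -v3.
    by clear -Hb v43 v8 v2; nra.
  have : 0 <= (1 + n%:R / H) ^+ (n * n) by apply: exprn_ge0; clear -nH0; lra.
  by move: (_ ^+ _) (_ * (n%:R / H)) => a b; clear; nra.
have lN : l ^+ (n * n) <= 1735 / 1000.
  have h1 : 0 <= s ^+ (n * n) by exact/exprn_ge0/sqrtr_ge0.
  have h2 : 0 <= (1 + n%:R / H) ^+ (n * n) by apply: exprn_ge0; clear -nH0; lra.
  rewrite exprMn; apply: le_trans (ler_pM h1 h2 sN dN) _; clear; lra.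
have B0 : 0 <= B by exact: ler0n.
have CB' : C%:R <= 1737 / 1000 * B.
  apply: le_trans CB _; apply: ler_wpM2r; [exact: B0|clear -lN; lra].
have m_ge : 2 * L - 1 <= m%:R.
  by have := truncnS_gt (2 * L); rewrite -natr1 -/m; clear; lra.
have M_le : M.+1%:R <= 2 * (e + n%:R) + 1.
  by rewrite -natr1 lerD2r truncn_le // mulr_ge0 // addr_ge0.
have L_big : 10 ^+ 6 * (w * n%:R ^+ 3) <= L.
  rewrite /L ler_pdivlMr //; apply: le_trans wHb; rewrite v43 le_eqVlt; apply/orP; left; apply/eqP; ring.
(* The main terms agree exactly, as n w e = L; the remainder w (2 n^2 + n) is negligible against L
   by [L_big]. *)
have ratio : n%:R * w * M.+1%:R <= 1001 / 1000 * m%:R.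
  apply: (@le_trans _ _ (n%:R * w * (2 * (e + n%:R) + 1))).
    by rewrite ler_wpM2l // mulr_ge0 // ltW.
  apply: (@le_trans _ _ (1001 / 1000 * (2 * L - 1))); last first.
    by apply: ler_wpM2l; [clear; lra|exact: m_ge].
  have -> : n%:R * w * (2 * (e + n%:R) + 1) = 2 * L + w * (2 * n%:R ^+ 2 + n%:R).
    by rewrite /e /L; field; rewrite !gt_eqF.
  have : w * (2 * n%:R ^+ 2 + n%:R) <= w * n%:R ^+ 3 * 2.
    by rewrite -mulrA ler_wpM2l // ?ltW // v3 v22; clear -v2; nra.
  have : 8 <= w * n%:R ^+ 3 by clear -w1 v8; nra.
  by clear -L_big; lra.
have m0 : 0 < m%:R :> R by apply: lt_le_trans m_ge; clear -L_big w1 v8; nra.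
have main' : S%:R * m%:R <= C%:R * M.+1%:R :> R by rewrite -!natrM ler_nat.
have S0 : 0 <= S%:R :> R by exact: ler0n.
have : n%:R * S%:R * w * m%:R <= 174 / 100 * B * m%:R.
  apply: (@le_trans _ _ (C%:R * (n%:R * w * M.+1%:R))).
    have -> : n%:R * S%:R * w * m%:R = (n%:R * w) * (S%:R * m%:R) by ring.
    have -> : C%:R * (n%:R * w * M.+1%:R) = (n%:R * w) * (C%:R * M.+1%:R) by ring.
    by rewrite ler_wpM2l // mulr_ge0 // ltW.
  have h1 : 0 <= n%:R * w * M.+1%:R by rewrite !mulr_ge0 // ltW.
  apply: le_trans (ler_pM (ler0n _ C) h1 CB' ratio) _.
  have : 0 <= B * m%:R by rewrite mulr_ge0 // ltW.
  by clear; lra.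
rewrite ler_pM2r // => h.
by rewrite mulrAC ler_pdivlMr.
Qed.

(** In dimension 1 the unit normal is 1 or -1. This serves the case n = 1, which the counting for n
    >= 2 leaves out. *)
Lemma normr_signed_dist1 (R : realType) (i : 'I_1) (x : 'M[int]_1) :
  `|signed_dist R i x| = int_norm R x.
Proof.
have [+ _] := unit_normalP R i x.
rewrite /signed_dist /dot !big_ord1 /int_norm /frobenius_norm !big_ord1 mxE sqrtr_sqr.
rewrite normrM [i]ord1 -expr2 => /eqP; rewrite sqrf_eq1 => /orP[] /eqP ->.
  by rewrite normr1 mul1r.
by rewrite normrN1 mul1r.
Qed.

Lemma ncard_gt0 (T : choiceType) (A : set T) (x : T) :
  finite_set A -> A x -> (0 < ncard A)%N.
Proof.
move=> finA Ax; rewrite -(ncard_set1 x).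
by apply: ncard_sub => // _ ->.
Qed.

Theorem theorem1 (R : realType) :
  exists c1 : R, 0 < c1 /\ c1 <= 10 /\
    forall (n : nat) (h w : R), (0 < n)%N -> 0 < h -> 0 < w -> 1 < w ->
      c1 * n%:R ^+ 4 * log2 n%:R + log2 w <= h ->
      1 - 2 / w <=
        uniform_probability R (points_of_bit_length_le n h)
          [set P | (point_condition_number R P < (w * n%:R `^ (5 / 2))%:E)%E].
Proof.
exists 10; split; first lra; split; first lra.
move=> n h w n0 h0 w0 w1 hw.
set A := points_of_bit_length_le n h; set E := [set P | _].
have finA : finite_set A by exact: finite_points.
rewrite /uniform_probability -/(ncard (A `&` E)) -/(ncard A).
(* For w <= 2 the claimed lower bound 1 - 2 / w is at most 0. *)
have [w2|w2] := leP w 2.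
  apply: (@le_trans _ _ 0); last by rewrite divr_ge0.
  by rewrite subr_le0 ler_pdivlMr // mul1r.
have ln2 : 0 < ln 2 :> R by rewrite ln_gt0 // ltr1n.
pose H : R := expR (h * ln 2).
have H1 : 1 < H by rewrite /H expR_gt1 mulr_gt0.
have A_AE : (ncard A <= ncard (A `&` E) + ncard (A `\` E))%N.
  rewrite -{1}(setUIDK A E) //; apply: ncardU.
  - by apply: sub_finite_set finA; exact: subIsetl.
  - exact: finite_setD.
suff [A0 AE] : 0 < (ncard A)%:R :> R /\ (ncard (A `\` E))%:R <= 2 / w * (ncard A)%:R :> R.
  rewrite ler_pdivlMr // mulrBl mul1r lerBlDr.
  by apply: (@le_trans _ _ (ncard (A `&` E) + ncard (A `\` E))%:R); rewrite ?ler_nat // natrD lerD2l.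
have sn0 : 0 < Num.sqrt n%:R :> R by rewrite sqrtr_gt0 ltr0n.
have nE : n%:R `^ (5 / 2) = n%:R ^+ 2 * Num.sqrt n%:R :> R.
  have -> : 5 / 2 = 2%:R + 2^-1 :> R by lra.
  rewrite powRD; last by rewrite pnatr_eq0 -lt0n n0 implybT.
  by rewrite powR_mulrn // powR12_sqrt.
have t0 : 0 < w * n%:R `^ (5 / 2) :> R by rewrite mulr_gt0 ?powR_gt0 ?ltr0n.
have e_eq (r : R) : Num.sqrt n%:R * r / (w * n%:R `^ (5 / 2)) = r / (w * n%:R ^+ 2).
  by rewrite nE; field; rewrite !gt_eqF ?ltr0n.
(* For n = 1 every point qualifies: the distance is the norm itself, which exceeds the norm divided
   by w > 1. The matrix 1 shows that points exist. *)
have [n1|n2] := leqP n 1.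
  have nn : n = 1%N by lia.
  have AsubE P : A P -> E P.
    move=> [P1 _]; rewrite /E /=; have [px _] := primitive_repP P1.
    have norm0 : 0 < int_norm R (primitive_rep P).
      exact: lt_le_trans (int_norm_ge1 R (primitive_neq0 px)).
    apply: (point_condition_number_lt n0 t0 norm0 P1) => //; first by left.
    move=> i; rewrite e_eq; move: i (primitive_rep P) norm0; rewrite nn => i x x0.
    rewrite normr_signed_dist1 expr1n mulr1 ltr_pdivrMr //.
    by rewrite ltr_pMr.
  split; last first.
    have -> : A `\` E = set0 by apply/seteqP; split=> // P [/AsubE].
    by rewrite /ncard fset_set0 cardfs0 mulr_ge0 // divr_ge0 // ltW.
  have p1 : primitive_ball n H (const_mx 1).
    split; last by move=> d /(_ (Ordinal n0) (Ordinal n0)); rewrite mxE dvdzE dvdn1 => /eqP.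
    apply: (@le_trans _ _ n%:R); last by rewrite [X in X%:R]nn ltW.
    by apply: frobenius_norm_le_dim => i j; rewrite !mxE mulr1z normr1.
  have := ncard_gt0 (finite_primitive_ball n H) p1.
  by have := ncard_primitive_ball_le n h; rewrite -/A -/H ltr0n; lia.
(* The constant 10 enters here: for n >= 2, 10 n^4 >= 160 >= 60, so 2 ^ h >= w n^60. *)
have wH : w * n%:R ^+ 60 <= H.
  have ln_n : 0 <= ln n%:R :> R by rewrite ln_ge0 // ler1n.
  rewrite -(lnK (_ : w \is Num.pos)) ?posrE // -{1}(lnK (_ : n%:R \is Num.pos)) ?posrE ?ltr0n //.
  rewrite -expRM_natl -expRD ler_expR.
  move: hw; rewrite /log2 -(ler_pM2r ln2) mulrDl !mulrA !divfK ?gt_eqF // => hw.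
  apply: le_trans hw; rewrite addrC lerD2r ler_wpM2r //.
  have : 16 <= n%:R ^+ 4 :> R.
    apply: (@le_trans _ _ (2 ^+ 4)); first by clear; lra.
    by apply: lerXn2r; rewrite ?nnegrE ?(ler_nat _ 2).
  by clear; lra.
have B_prim : 879 / 1000 * (ncard (lattice_ball n H))%:R <= (ncard (primitive_ball n H))%:R :> R.
  apply: ncard_primitive_ball_ge => //; apply: le_trans wH.
  by apply: ler_peMl; rewrite ?exprn_ge0 // ltW.
have prim_A : (ncard (primitive_ball n H))%:R <= 2 * (ncard A)%:R :> R.
  by rewrite -natrM ler_nat; exact: ncard_primitive_ball_le.
pose S (i : 'I_n) := slab i (H / (w * n%:R ^+ 2)) H.
have finS i : finite_set (S i).
  by apply: sub_finite_set (finite_lattice_ball n H) => x [].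
have H0 : 0 < H := expR_gt0 _.
(* By [e_eq] the distance threshold for k(M) < w n^(5/2) is H / (w n^2), so a matrix outside all
   slabs gives a point of [E]. *)
have AE_S : (2 * ncard (A `\` E) <= \sum_i ncard (S i))%N.
  apply: leq_trans (ncard_bigsetU finS); apply: ncard_points_le.
    exact: finite_bigsetU.
  move=> P x Ph PE xP; apply: contrapT => xS; apply: PE; rewrite /E /=.
  have [P1 _] := Ph; have [xH _] := points_primitive_ball Ph.
  have {}xH : lattice_ball n H x by case: xP => ->; rewrite // /lattice_ball /= int_normN.
  apply: (point_condition_number_lt n0 t0 H0 P1 xP xH) => i.
  rewrite ltNge; apply/negP => di; apply: xS.
  by apply: (@sub_bigsetU _ _ _ i); split=> //; rewrite -e_eq.
have S_B : \sum_i (ncard (S i))%:R <= 174 / 100 / w * (ncard (lattice_ball n H))%:R :> R.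
  have nR0 : 0 < n%:R :> R by rewrite ltr0n.
  rewrite -(ler_pM2l nR0) mulr_sumr.
  apply: (@le_trans _ _ (\sum_(i < n) (174 / 100 / w * (ncard (lattice_ball n H))%:R))).
    apply: ler_sum => i _; exact: ncard_slab_fraction n2 (ltW w1) wH.
  by rewrite sumr_const card_ord [leRHS]mulr_natl.
have B1 : 1 <= (ncard (lattice_ball n H))%:R :> R.
  rewrite ler1n; apply: (ncard_gt0 (x := 0)); first exact: finite_lattice_ball.
  rewrite /lattice_ball /= /int_norm map_mx0.
  by rewrite (eqP (_ : frobenius_norm 0 == 0)) ?frobenius_norm_eq0 // ltW.
have AE_S' : 2 * (ncard (A `\` E))%:R <= \sum_i (ncard (S i))%:R :> R.
  by rewrite -natr_sum -natrM ler_nat.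
(* It remains to combine 2 ae <= 1.74 b / w with 0.879 b <= p <= 2 a, and 1.74 / 0.879 < 2. *)
move: (ncard (lattice_ball n H))%:R (ncard (primitive_ball n H))%:R (ncard A)%:R
  (ncard (A `\` E))%:R (\sum_i _) B1 B_prim prim_A S_B AE_S' => b p a ae s b1 bp pa sb aes.
split; first by clear -b1 bp pa; lra.
rewrite mulrAC ler_pdivlMr //; move: sb; rewrite mulrAC ler_pdivlMr // => sb.
have : 2 * (ae * w) <= s * w by rewrite mulrA ler_wpM2r // ltW.
by clear -sb b1 bp pa; lra.
Qed.
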